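(* For all $\varepsilon>0$, there exists $C>0$ such that for every $\delta>0$ the following holds. Let $G$ be a $\Delta$-regular graph on $n$ vertices with $\mathrm{girth}(G)\ge6$ and $\Delta\ge C\log(n/\delta)$. Let $0<\lambda\le(1-\varepsilon)e/\Delta$. Then there is a (randomized) algorithm which outputs a random independent set of $G$ whose distribution is within variation distance $\delta$ of the Gibbs distribution at fugacity $\lambda$, with running time polynomial in $n$, $1/\varepsilon$ and $\log(1/\delta)$.
   Context: For a finite simple graph $G=(V,E)$ and a fugacity $\lambda>0$, let $\Omega$ be the set of independent sets of $G$. The Gibbs distribution (hard-core lattice gas model) at fugacity $\lambda$ is the distribution $\pi$ on $\Omega$ with $\pi(X)=\lambda^{|X|}/Z$, where $Z=\sum_{X\in\Omega}\lambda^{|X|}$. Here $e$ is the base of natural logarithms. The girth is the length of a shortest cycle. Variation distance is $\|\mu-\nu\|_{\mathrm{TV}}=\frac12\sum_x|\mu(x)-\nu(x)|$. The algorithm takes $G,\lambda,\varepsilon,\delta$ as input, and ''polynomial running time'' means bounded by a fixed polynomial not depending on the input. *)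

(* Defs.v *)
From mathcomp Require Import all_boot all_order all_algebra.
From mathcomp Require Import all_classical all_reals all_analysis.
(* Not imported: the notations of mpoly clash with those of analysis. *)
From mathcomp Require mpoly.

Set Implicit Arguments.
Unset Strict Implicit.
Unset Printing Implicit Defensive.

Import Order.TTheory GRing.Theory Num.Theory.

Local Open Scope ring_scope.

Section Graphs.
Variables (R : realType) (n : nat) (e : rel 'I_n).

Definition simple_graph : Prop := symmetric e /\ irreflexive e.

Definition regular (D : nat) : Prop := forall v, #|e v| = D.

(* [e] being symmetric, closed walks of length 2 have to be excluded. *)
Definition is_cycle (c : seq 'I_n) : Prop := (2 < size c)%N /\ ucycle e c.

(* [+oo] for a forest. *)
Definition girth : \bar R :=
  ereal_inf [set ((size c)%:R)%:E | c in is_cycle]%classic.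

Definition independent (X : {set 'I_n}) : bool :=
  [forall u in X, forall v in X, ~~ e u v].

Definition partition_function (lambda : R) : R :=
  \sum_(X : {set 'I_n} | independent X) lambda ^+ #|X|.

(* The Gibbs distribution, extended by 0 to all sets of vertices. *)
Definition gibbs (lambda : R) (X : {set 'I_n}) : R :=
  if independent X then lambda ^+ #|X| / partition_function lambda else 0.

End Graphs.

Definition tv_dist (R : realType) (T : finType) (mu nu : T -> R) : R :=
  2^-1 * \sum_(x : T) `|mu x - nu x|.

(* Randomized algorithms are programs for a unit-cost real RAM with fair coins.
   The memory consists of two arrays of registers: N[0], N[1], ... hold natural
   numbers, which may serve as addresses, and X[0], X[1], ... hold real numbers.
   In the list below the operands d, a, b are register numbers, and [i <- v]
   stands for an assignment.  Programs contain no real constants, and reals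
   cannot be rounded to integers. *)
Inductive instr : Type :=
| NConst (d c : nat)    (* N[d] <- c *)
| NAdd (d a b : nat)    (* N[d] <- N[a] + N[b] *)
| NSub (d a b : nat)    (* N[d] <- N[a] - N[b], truncated at 0 *)
| NLoad (d a : nat)     (* N[d] <- N[N[a]] *)
| NStore (d a : nat)    (* N[N[d]] <- N[a] *)
| Adj (d a b : nat)     (* N[d] <- 1 if N[a], N[b] are adjacent vertices of the
                           input graph, 0 otherwise *)
| Coin (d : nat)        (* N[d] <- a fresh fair random bit *)
| RCast (d a : nat)     (* X[d] <- N[a] *)
| RAdd (d a b : nat)    (* X[d] <- X[a] + X[b] *)
| RSub (d a b : nat)    (* X[d] <- X[a] - X[b] *)
| RMul (d a b : nat)    (* X[d] <- X[a] * X[b] *)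
| RDiv (d a b : nat)    (* X[d] <- X[a] / X[b], which is 0 if X[b] = 0 *)
| RLoad (d a : nat)     (* X[d] <- X[N[a]] *)
| RStore (d a : nat).   (* X[N[d]] <- X[a] *)

Inductive test : Type :=
| NLe (a b : nat)       (* N[a] <= N[b] *)
| RLe (a b : nat).      (* X[a] <= X[b] *)

Inductive program : Type :=
| Do (i : instr)
| Seq (p q : program)
| If (t : test) (p q : program)
| While (t : test) (p : program).

Definition upd (A : Type) (f : nat -> A) (i : nat) (v : A) : nat -> A :=
  fun j => if j == i then v else f j.

Section Machine.
Variables (R : realType) (n : nat) (e : rel 'I_n).

Record memory : Type := Memory { nreg : nat -> nat; rreg : nat -> R }.

Definition setN (m : memory) (d v : nat) : memory :=
  Memory (upd (nreg m) d v) (rreg m).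

Definition setX (m : memory) (d : nat) (v : R) : memory :=
  Memory (nreg m) (upd (rreg m) d v).

Definition adjacent (i j : nat) : bool :=
  match (insub i : option 'I_n), (insub j : option 'I_n) with
  | Some u, Some v => e u v
  | _, _ => false
  end.

(* [bit] is the random bit available during the current step. *)
Definition exec (bit : bool) (i : instr) (m : memory) : memory :=
  let N := nreg m in
  let X := rreg m in
  match i with
  | NConst d c => setN m d c
  | NAdd d a b => setN m d (N a + N b)%N
  | NSub d a b => setN m d (N a - N b)%N
  | NLoad d a => setN m d (N (N a))
  | NStore d a => setN m (N d) (N a)
  | Adj d a b => setN m d (adjacent (N a) (N b))
  | Coin d => setN m d bit
  | RCast d a => setX m d (N a)%:R
  | RAdd d a b => setX m d (X a + X b)
  | RSub d a b => setX m d (X a - X b)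
  | RMul d a b => setX m d (X a * X b)
  | RDiv d a b => setX m d (X a / X b)
  | RLoad d a => setX m d (X (N a))
  | RStore d a => setX m (N d) (X a)
  end.

Definition holds (t : test) (m : memory) : bool :=
  match t with
  | NLe a b => (nreg m a <= nreg m b)%N
  | RLe a b => rreg m a <= rreg m b
  end.

(* A stack of programs that remain to be executed, and the memory; the machine
   has halted when the stack is empty. *)
Definition config : Type := (seq program * memory)%type.

Definition step (c : config) (bit : bool) : config :=
  let: (k, m) := c in
  match k with
  | [::] => c
  | Do i :: k' => (k', exec bit i m)
  | Seq p q :: k' => (p :: q :: k', m)
  | If t p q :: k' => ((if holds t m then p else q) :: k', m)
  | While t p :: k' =>
      if holds t m then (p :: While t p :: k', m) else (k', m)
  end.

(* On input (G, lambda, eps, delta), N[0] is the number of vertices, X[0], X[1]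
   and X[2] are the three real parameters, and all other registers are 0.  The
   graph itself can only be accessed through the instruction [Adj]. *)
Definition init (lambda eps delta : R) (p : program) : config :=
  ([:: p],
   Memory (upd (fun=> 0%N) 0%N n) (nth 0 [:: lambda; eps; delta])).

(* One fresh bit is supplied at every step, whether or not it is used, so that a
   run of T steps is determined by T independent fair bits. *)
Definition run (c : config) (bits : seq bool) : config := foldl step c bits.

Definition halted (c : config) : bool := nilp c.1.

(* The output is given by its characteristic vector, starting at the address
   stored in N[0]. *)
Definition output (c : config) : {set 'I_n} :=
  finset (fun i : 'I_n => nreg c.2 (nreg c.2 0%N + i)%N != 0%N).

(* The distribution of the output after T steps. *)
Definition output_dist (c : config) (T : nat) (X : {set 'I_n}) : R :=
  #|finset (fun bits : T.-tuple bool => output (run c bits) == X)|%:R / 2 ^+ T.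

End Machine.

(* The value p(x, y, z). *)
Definition eval3 (R : realType) (p : mpoly.mpoly 3 R) (x y z : R) : R :=
  mpoly.meval (fun i : 'I_3 => nth 0 [:: x; y; z] i) p.

(* Main.v *)
(* Sample by Glauber dynamics with a slowly increasing fugacity: n stages, at
   fugacities lam_1 <= ... <= lam_n close to lambda, stage s started from the
   outcome of stage s - 1.  All acceptance probabilities are dyadic, so every stage
   is exactly the Glauber dynamics of a hard-core model with lam_s <= lambda.

   Stage s is analysed by coupling X ~ gibbs lam_(s-1) with a stationary
   Y ~ gibbs lam_s, using the same vertex and the same coin for both.  A vertex v
   of X \ Y can only cause a disagreement at those neighbours which are unblocked in
   Y, so the expected number of disagreements contracts as soon as, in X and in Y,
   every vertex has fewer than (1 + lam_s) / lam_s unblocked neighbours.  Both laws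
   are at most a constant times gibbs lam_s, and stay so under the dynamics; hence
   it suffices that this local condition fails with tiny probability under
   gibbs lam_s.

   For the latter let S(v) count the neighbours w of v without an occupied
   neighbour other than v.  Girth 6 makes the stars {w} + N(w) - v pairwise
   disjoint and non-adjacent, so S(v) concentrates around the sum over w of
   exp(- mu S(w)), where mu = ln (1 + lambda).  Thus the extreme values U and L of
   mu S satisfy U <= c exp(- L) and L >= c exp(- U) up to small errors, with
   c = mu D <= (1 - eps) e, and this forces U < 1. *)
Require Import Defs.
From mathcomp Require Import all_boot all_order all_algebra.
From mathcomp Require Import all_classical all_reals all_analysis.
From mathcomp Require mpoly.
From mathcomp Require Import ring lra zify.

(* Canonical structures only: the notations of mpoly clash with those of analysis. *)
Import (canonicals) mpoly.

Set Implicit Arguments.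
Unset Strict Implicit.
Unset Printing Implicit Defensive.

Import Order.TTheory GRing.Theory Num.Theory.

Local Open Scope ring_scope.

(** * Expected outcome of a program *)

Section Expectation.
Variables (R : realType) (n : nat) (e : rel 'I_n).
Implicit Types (F : config R -> R) (c : config R) (m : memory R)
  (k : seq program) (p q : program).

(** Recursion on the first bit mirrors the machine: a coin toss averages two continuations, and
    every other step ignores its bit. [expectE] recovers the average over all bit strings. *)
Fixpoint expect (T : nat) F c : R :=
  if T is T'.+1 then (expect T' F (step e c true) + expect T' F (step e c false)) / 2
  else F c.

Lemma expectE T F c :
  expect T F c = (\sum_(bits : T.-tuple bool) F (run e c bits)) / 2 ^+ T.
Proof.
elim: T c => [|T IH] c /=.
  rewrite expr0 divr1 (big_pred1 [tuple]) //= => t.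
  by rewrite [t]tuple0 /= eqxx.
rewrite !IH.
have -> : \sum_(bits : T.+1.-tuple bool) F (run e c bits) =
  \sum_(b : bool) \sum_(bits : T.-tuple bool) F (run e (step e c b) bits).
  rewrite pair_bigA /=.
  rewrite (reindex (fun x : bool * T.-tuple bool => cons_tuple x.1 x.2)) //=.
  exists (fun t : T.+1.-tuple bool => (thead t, [tuple of behead t])).
    by move=> [b t] _ /=; rewrite theadE; congr pair; apply: val_inj.
  by move=> t _; apply: val_inj; rewrite /= [in RHS](tuple_eta t).
rewrite big_bool /= exprS invfM; ring.
Qed.

(** A halted machine idles, so quantifying over all later times lets branches that halt at different
    moments be averaged at a common time. *)
Definition value F c (t : nat) (x : R) : Prop :=
  forall T, (t <= T)%N -> expect T F c = x.

Lemma value_le F c t t' x : (t <= t')%N -> value F c t x -> value F c t' x.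
Proof. by move=> tt' H T t'T; apply: H; apply: leq_trans t'T. Qed.

Lemma value_halt F m : value F ([::], m) 0 (F ([::], m)).
Proof.
move=> T _; elim: T => //= T ->.
by field.
Qed.

Lemma value_step F c t x y :
  value F (step e c true) t x -> value F (step e c false) t y ->
  value F c t.+1 ((x + y) / 2).
Proof. by move=> Hx Hy [//|T] tT /=; rewrite Hx ?Hy. Qed.

Lemma value_det F c c' t x :
  step e c true = c' -> step e c false = c' ->
  value F c' t x -> value F c t.+1 x.
Proof.
move=> H1 H2 H; have -> : x = (x + x) / 2.
  by field.
by apply: value_step; rewrite ?H1 ?H2.
Qed.

Definition is_coin i := if i is Coin _ then true else false.

Lemma value_do F i k m t x : ~~ is_coin i ->
  value F (k, exec e false i m) t x -> value F (Do i :: k, m) t.+1 x.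
Proof. by move=> Hi; apply: value_det => //; case: i Hi. Qed.

Lemma value_coin F d k m t x y :
  value F (k, setN m d 1) t x -> value F (k, setN m d 0) t y ->
  value F (Do (Coin d) :: k, m) t.+1 ((x + y) / 2).
Proof. by move=> Hx Hy; apply: value_step. Qed.

Lemma value_seq F p q k m t x :
  value F (p :: q :: k, m) t x -> value F (Seq p q :: k, m) t.+1 x.
Proof. exact: value_det. Qed.

Lemma value_if F b p q k m t x :
  value F ((if holds b m then p else q) :: k, m) t x ->
  value F (If b p q :: k, m) t.+1 x.
Proof. exact: value_det. Qed.

Lemma value_while_true F b p k m t x : holds b m ->
  value F (p :: While b p :: k, m) t x -> value F (While b p :: k, m) t.+1 x.
Proof. by move=> Hb; apply: value_det => /=; rewrite Hb. Qed.

Lemma value_while_false F b p k m t x : ~~ holds b m ->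
  value F (k, m) t x -> value F (While b p :: k, m) t.+1 x.
Proof. by move=> Hb; apply: value_det => /=; rewrite (negbTE Hb). Qed.

Fixpoint block i (s : seq instr) : program :=
  if s is j :: s' then Seq (Do i) (block j s') else Do i.

(** Unfolding a [Seq] costs a step, hence two steps per instruction and one for the last. *)
Lemma value_block F i s k m t x : all (predC is_coin) (i :: s) ->
  value F (k, foldl (fun m i => exec e false i m) m (i :: s)) t x ->
  value F (block i s :: k, m) (2 * size s + 1 + t) x.
Proof.
elim: s i m => [|j s IH] i m /=.
  by rewrite andbT => Hi H; exact: value_do.
case/andP => Hi Hs H.
apply: (value_le (t := (2 * size s + 1 + t).+2)%N); first by lia.
by apply/value_seq/value_do => //; apply: IH.
Qed.

End Expectation.

(** * The program *)

Section Update.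
Variables (n : nat) (e : rel 'I_n).

Definition blocked (X : {set 'I_n}) (w : 'I_n) : bool := [exists u, e w u && (u \in X)].

(** The heat-bath move of Glauber dynamics: [b] is the proposal to occupy [w]; without it, or if [w]
    is blocked, [w] is vacated. *)
Definition update (X : {set 'I_n}) (w : 'I_n) (b : bool) : {set 'I_n} :=
  if b && ~~ blocked X w then w |: X else X :\ w.

(** The program draws [v] below a power of two exceeding [n]; a draw that is no vertex becomes a
    lazy step. *)
Definition update_nat (X : {set 'I_n}) (v : nat) (b : bool) : {set 'I_n} :=
  if insub v is Some w then update X w b else X.

End Update.

(** The average of [c] over the numbers whose binary digits are those of [B] followed by [k] fair
    bits, in the order in which the program draws them. *)
Fixpoint bitavg (R : realType) (k B : nat) (c : nat -> R) : R :=
  if k is k'.+1 then (bitavg k' (B + B + 1) c + bitavg k' (B + B + 0) c) / 2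
  else c B.

Lemma bitavgE (R : realType) k B (c : nat -> R) :
  bitavg k B c = (\sum_(b < 2 ^ k) c (B * 2 ^ k + b)%N) / 2 ^+ k.
Proof.
elim: k B => [|k IH] B /=.
  by rewrite big_ord_recl big_ord0 expr0 divr1 addr0 muln1 addn0.
rewrite !IH -(big_mkord xpredT (fun b => c (B * 2 ^ k.+1 + b)%N)).
rewrite (@big_cat_nat _ _ _ (2 ^ k)%N) //=; last by rewrite leq_pexp2l.
rewrite -[X in _ + \sum_(X <= _ < _) _](add0n (2 ^ k)%N) big_addn expnS mul2n -addnn.
rewrite addnK !big_mkord.
have -> : \sum_(b < 2 ^ k) c ((B + B + 1) * 2 ^ k + b)%N =
  \sum_(b < 2 ^ k) c (B * (2 ^ k + 2 ^ k) + (b + 2 ^ k))%N.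
  by apply: eq_bigr => b _; congr c; lia.
have -> : \sum_(b < 2 ^ k) c ((B + B + 0) * 2 ^ k + b)%N =
  \sum_(b < 2 ^ k) c (B * (2 ^ k + 2 ^ k) + b)%N.
  by apply: eq_bigr => b _; congr c; lia.
rewrite exprS invfM; ring.
Qed.

Lemma upd_neq (A : Type) (f : nat -> A) d v j : j != d -> upd f d v j = f j.
Proof. by rewrite /upd => /negbTE ->. Qed.

(* Register usage: N[1] = 1, N[2] = 16 is the address of the current set,
   N[3] the number l of bits of precision, N[4] the stage, N[5], ..., N[15]
   scratch; X[3] = 1, X[4] = n, X[6] = 2 ^ l, X[8] the number of steps per stage,
   X[9] the increment of the acceptance threshold X[10], X[11] the step. *)
Definition pick_vertex : program :=
  Seq (block (NConst 5 0) [:: NConst 6 1])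
    (While (NLe 6 0) (Seq (Do (Coin 7)) (block (NAdd 5 5 5) [:: NAdd 5 5 7; NAdd 6 6 6]))).

Definition pick_number : program :=
  Seq (block (NConst 8 0) [:: NConst 9 1])
    (While (NLe 9 3) (Seq (Do (Coin 7)) (block (NAdd 8 8 8) [:: NAdd 8 8 7; NAdd 9 9 1]))).

(* The membership bit N[10] of the chosen vertex N[5] is decremented (truncated
   at 0) by N[13] - 1, where N[13] is 2 if N[11] is an occupied neighbour of N[5],
   and 0 or 1 otherwise. *)
Definition scan_neighbors : program :=
  While (NLe 12 0)
    (block (Adj 13 5 11) [:: NAdd 14 2 11; NLoad 14 14; NAdd 13 13 14; NSub 13 13 1;
                             NSub 10 10 13; NAdd 11 11 1; NAdd 12 12 1]).

(** N[8] consists of [l] random bits, and the proposal is accepted if N[8] + 1 is at most X[10];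
    thus the real threshold never has to be rounded. *)
Definition update_vertex : program :=
  Seq (block (NAdd 8 8 1) [:: RCast 12 8; NConst 11 0; NConst 12 1])
    (Seq (If (RLe 12 10) (Do (NConst 10 1)) (Do (NConst 10 0)))
       (Seq scan_neighbors (block (NAdd 14 2 5) [:: NStore 14 10]))).

Definition glauber_step : program :=
  Seq pick_vertex (Seq pick_number update_vertex).

Definition glauber_stage : program :=
  Seq (block (RAdd 10 10 9) [:: RCast 11 1])
    (Seq (While (RLe 11 8) (Seq glauber_step (Do (RAdd 11 11 3))))
       (Do (NAdd 4 4 1))).

(** The first loop finds the least [l] with 2 ^ l > n ^ 2 / delta. Each of the n stages then raises
    the threshold by lambda / (1 + lambda) * 2 ^ l / n and makes n * n * l steps. The initial set is
    empty because the registers from N[16] on are 0; N[0] holds n until it receives the address of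
    the output. *)
Definition annealed_glauber : program :=
  Seq (block (NConst 1 1) [:: NConst 2 16; RCast 3 1; RCast 4 0; RMul 5 4 4; RDiv 5 5 2;
                             RCast 6 1])
    (Seq (While (RLe 6 5) (block (RAdd 6 6 6) [:: NAdd 3 3 1]))
       (Seq (block (RCast 7 3) [:: RMul 8 4 4; RMul 8 8 7; RAdd 9 3 0; RDiv 9 0 9;
                                   RMul 9 9 6; RDiv 9 9 4; NConst 4 1])
          (Seq (While (NLe 4 0) glauber_stage) (Do (NConst 0 16))))).

(** * Correctness and step count of the program *)

Section Correctness.
Variables (R : realType) (n : nat) (e : rel 'I_n) (F : config R -> R).
Variables (l N : nat) (theta : R).
Implicit Types (m : memory R) (k : seq program) (X : {set 'I_n}) (g : {set 'I_n} -> R).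

(** The invariant shared by all pieces of a stage: [i] is the stage, [tau] the threshold, [j] the
    step counter, [X] the current set. Nothing is said about scratch registers. *)
Record state m (i : nat) (tau j : R) X : Prop := State {
  stN0 : nreg m 0%N = n;
  stN1 : nreg m 1%N = 1%N;
  stN2 : nreg m 2%N = 16%N;
  stN3 : nreg m 3%N = l;
  stN4 : nreg m 4%N = i;
  stX3 : rreg m 3%N = 1;
  stX8 : rreg m 8%N = N%:R;
  stX9 : rreg m 9%N = theta;
  stX10 : rreg m 10%N = tau;
  stX11 : rreg m 11%N = j;
  stA : forall u : 'I_n, nreg m (16 + u)%N = (u \in X) :> nat }.

Lemma state_setN m i tau j X d v : (4 < d < 16)%N ->
  state m i tau j X -> state (setN m d v) i tau j X.
Proof.
move=> Hd [*]; split; rewrite /= ?upd_neq //; try lia.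
by move=> u; rewrite upd_neq; [auto | lia].
Qed.

Lemma state_setX m i tau j X v :
  state m i tau j X -> state (Defs.setX m 12 v) i tau j X.
Proof. by case=> *; split. Qed.

Variable kappa : nat.
Hypothesis kappaP : forall s, (2 ^ s <= n)%N = (s < kappa)%N.

Lemma value_pick_vertex k m i tau j X t c : state m i tau j X ->
  (forall v m', state m' i tau j X -> nreg m' 5%N = v -> value e F (k, m') t (c v)) ->
  value e F (pick_vertex :: k, m) (8 * kappa + 5 + t) (bitavg kappa 0 c).
Proof.
move=> Hm Hk.
(* After [s] bits N[6] is 2 ^ s, so exactly [kappa] bits are drawn, whatever their values. *)
suff loop r s v m' : (s + r = kappa)%N -> state m' i tau j X -> nreg m' 5%N = v ->
    nreg m' 6%N = (2 ^ s)%N ->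
    value e F (While (NLe 6 0) (Seq (Do (Coin 7))
      (block (NAdd 5 5 5) [:: NAdd 5 5 7; NAdd 6 6 6])) :: k, m') (8 * r + 1 + t)
      (bitavg r v c).
  apply: (value_le (t := (2 * 1 + 1 + (8 * kappa + 1 + t)).+1)%N); first by lia.
  apply/value_seq/value_block => //; apply: (loop _ 0%N) => //.
  by do !apply: state_setN => //.
elim: r s v m' => [|r IH] s v m' Hs Hm' Hv Hp.
  rewrite muln0 add0n; apply: value_while_false; last exact: Hk.
  by rewrite /= Hp (stN0 Hm') kappaP; lia.
apply: (value_le (t := (2 * 2 + 1 + (8 * r + 1 + t)).+3)%N); first by lia.
apply: value_while_true; first by rewrite /= Hp (stN0 Hm') kappaP; lia.
by apply/value_seq/value_coin; apply: value_block => //; apply: (IH s.+1);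
  rewrite /= /upd /= ?Hv ?Hp ?expnS; (try lia); do !apply: state_setN => //.
Qed.

Lemma value_pick_number k m i tau j X v t c : state m i tau j X -> nreg m 5%N = v ->
  (forall b m', state m' i tau j X -> nreg m' 5%N = v -> nreg m' 8%N = b ->
     value e F (k, m') t (c b)) ->
  value e F (pick_number :: k, m) (8 * l + 5 + t) (bitavg l 0 c).
Proof.
move=> Hm Hv Hk.
suff loop r s b m' : (s + r = l)%N -> state m' i tau j X -> nreg m' 5%N = v ->
    nreg m' 8%N = b -> nreg m' 9%N = s.+1 ->
    value e F (While (NLe 9 3) (Seq (Do (Coin 7))
      (block (NAdd 8 8 8) [:: NAdd 8 8 7; NAdd 9 9 1])) :: k, m') (8 * r + 1 + t)
      (bitavg r b c).
  apply: (value_le (t := (2 * 1 + 1 + (8 * l + 1 + t)).+1)%N); first by lia.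
  apply/value_seq/value_block => //; apply: (loop _ 0%N) => //.
  by do !apply: state_setN => //.
elim: r s b m' => [|r IH] s b m' Hs Hm' Hv' Hb Hc.
  rewrite muln0 add0n; apply: value_while_false; last exact: Hk.
  by rewrite /= Hc (stN3 Hm'); lia.
apply: (value_le (t := (2 * 2 + 1 + (8 * r + 1 + t)).+3)%N); first by lia.
apply: value_while_true; first by rewrite /= Hc (stN3 Hm'); lia.
by apply/value_seq/value_coin; apply: value_block => //; apply: (IH s.+1);
  rewrite /= /upd /= ?Hb ?Hc ?(stN1 Hm'); (try lia); do !apply: state_setN => //.
Qed.

(** Loop invariant of the neighbour scan: what has been seen once the vertices below [u] are
    done. *)
Definition hit v u X : bool := [exists w : 'I_n, [&& (w < u)%N, Defs.adjacent e v w & w \in X]].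

Lemma hitS v X (u : 'I_n) : hit v u.+1 X = hit v u X || (Defs.adjacent e v u && (u \in X)).
Proof.
apply/existsP/orP => [[w /and3P[wu ew wX]]|[/existsP[w /and3P[wu ew wX]]|/andP[eu uX]]].
- case: (ltngtP w u) => Hwu; [left | lia | right].
    by apply/existsP; exists w; rewrite Hwu ew wX.
  by move: ew wX; rewrite (val_inj Hwu : w = u) => -> ->.
- by exists w; rewrite ew wX ltnS ltnW.
- by exists u; rewrite eu uX ltnSn.
Qed.

Lemma value_scan_neighbors k m i tau j X v (b : bool) t x : state m i tau j X -> nreg m 5%N = v ->
  nreg m 10%N = b -> nreg m 11%N = 0%N -> nreg m 12%N = 1%N ->
  (forall m', state m' i tau j X -> nreg m' 5%N = v ->
     nreg m' 10%N = b && ~~ hit v n X -> value e F (k, m') t x) ->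
  value e F (scan_neighbors :: k, m) (16 * n + 1 + t) x.
Proof.
move=> Hm Hv Hb H11 H12 Hk.
suff loop r u m' : (u + r = n)%N -> state m' i tau j X -> nreg m' 5%N = v ->
    nreg m' 10%N = b && ~~ hit v u X -> nreg m' 11%N = u -> nreg m' 12%N = u.+1 ->
    value e F (scan_neighbors :: k, m') (16 * r + 1 + t) x.
  apply: (loop _ 0%N) => //.
  have -> : hit v 0 X = false by apply/existsP => -[].
  by rewrite andbT.
elim: r u m' => [|r IH] u m' Hu Hm' Hv' Hb' H11' H12'.
  rewrite muln0 add0n; apply: value_while_false.
    by rewrite /= H12' (stN0 Hm'); lia.
  by apply: Hk => //; rewrite Hb' -Hu addn0.
apply: (value_le (t := (2 * 7 + 1 + (16 * r + 1 + t)).+1)%N); first by lia.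
have un : (u < n)%N by lia.
apply: value_while_true; first by rewrite /= H12' (stN0 Hm').
apply: value_block => //; apply: (IH u.+1); rewrite /= /upd /= ?(stN1 Hm') ?H11' ?H12'; try lia.
- by do !apply: state_setN => //.
- have /= := stA Hm' (Ordinal un); rewrite (stN2 Hm') Hv' => ->.
  rewrite (hitS _ _ (Ordinal un)) Hb' /=.
  (* The truncated subtractions clear the bit exactly when adjacency and occupation are both 1. *)
  by case: (b); case: hit; case: Defs.adjacent; case: (_ \in X).
Qed.

Lemma value_update_vertex k m i tau j X v b t g : state m i tau j X -> nreg m 5%N = v ->
  nreg m 8%N = b ->
  (forall m' X', state m' i tau j X' -> value e F (k, m') t (g X')) ->
  value e F (update_vertex :: k, m) (16 * n + 20 + t) (g (update_nat e X v (b.+1%:R <= tau))).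
Proof.
move=> Hm Hv Hb Hk.
apply: (value_le (t := (2 * 3 + 1 + (16 * n + 1 + (2 * 1 + 1 + t)).+1.+3).+1)%N); first by lia.
apply/value_seq/value_block => //; apply/value_seq/value_if; set m1 := foldl _ _ _.
have Hm1 : state m1 i tau j X by do 2!apply: state_setN => //; apply/state_setX/state_setN.
have HX12 : rreg m1 12%N = b.+1%:R by rewrite /m1 /= /upd /= Hb (stN1 Hm) addn1.
have -> : holds (RLe 12 10) m1 = (b.+1%:R <= tau) by rewrite -HX12 -(stX10 Hm1).
suff rest m2 (a : bool) : state m2 i tau j X -> nreg m2 5%N = v -> nreg m2 10%N = a ->
    nreg m2 11%N = 0%N -> nreg m2 12%N = 1%N ->
    value e F (Seq scan_neighbors (block (NAdd 14 2 5) [:: NStore 14 10]) :: k, m2)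
      (16 * n + 1 + (2 * 1 + 1 + t)).+1 (g (update_nat e X v a)).
  by case: (_ <= tau); apply: value_do => //; apply: rest => //; apply: state_setN.
move=> Hm2 Hv2 Ha H11 H12; apply: value_seq.
apply: (value_scan_neighbors Hm2 Hv2 Ha H11 H12) => m3 Hm3 Hv3 H10.
apply: value_block => //; apply: Hk.
case: (Hm3) => *; split; rewrite /= /upd /= ?(stN2 Hm3) ?Hv3 //.
move=> u; rewrite eqn_add2l H10.
rewrite (stA Hm3) /update_nat; case: insubP => [w wn wv|]; last first.
  by rewrite -leqNgt => vn; rewrite ltn_eqF // (leq_trans (ltn_ord u) vn).
have hitE : hit v n X = blocked e X w.
  apply/existsP/existsP => -[y].
    move=> /and3P[_ ey yX]; exists y; move: ey.
    by rewrite /Defs.adjacent -wv !valK yX andbT.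
  by move=> /andP[ey yX]; exists y; rewrite /Defs.adjacent -wv !valK ltn_ord ey.
rewrite hitE /update -{1}wv (inj_eq val_inj).
have [->|uw] := eqVneq u w.
  by case: ifP => _; rewrite ?setU11 ?setD11.
by case: ifP => _; rewrite !inE (negbTE uw).
Qed.

(** Operators act on observables: this is the expected value of [g] after one step from [X], so
    compositions run backwards in time. *)
Definition step_op (tau : R) g X : R :=
  bitavg kappa 0 (fun v => bitavg l 0 (fun b => g (update_nat e X v (b.+1%:R <= tau)))).

Definition step_time : nat := (8 * kappa + 8 * l + 16 * n + 32)%N.

Lemma value_glauber_step k m i tau j X t g : state m i tau j X ->
  (forall m' X', state m' i tau j X' -> value e F (k, m') t (g X')) ->
  value e F (glauber_step :: k, m) (step_time + t) (step_op tau g X).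
Proof.
move=> Hm Hk.
apply: (value_le
  (t := (8 * kappa + 5 + (8 * l + 5 + (16 * n + 20 + t)).+1).+1)%N).
  by rewrite /step_time; lia.
apply/value_seq/(value_pick_vertex Hm) => v m1 Hm1 Hv1.
apply/value_seq/(value_pick_number Hm1 Hv1) => b m2 Hm2 Hv2 Hb2.
exact: value_update_vertex Hm2 Hv2 Hb2 Hk.
Qed.

Definition stage_time : nat := (N * (step_time + 3) + 10)%N.

Lemma value_glauber_stage k m i tau j X t g : state m i tau j X ->
  (forall m' X', state m' i.+1 (tau + theta) N.+1%:R X' -> value e F (k, m') t (g X')) ->
  value e F (glauber_stage :: k, m) (stage_time + t) (iter N (step_op (tau + theta)) g X).
Proof.
move=> Hm Hk.
suff loop r s m' X' : (s + r = N)%N -> state m' i (tau + theta) s.+1%:R X' ->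
    value e F (While (RLe 11 8) (Seq glauber_step (Do (RAdd 11 11 3))) :: Do (NAdd 4 4 1) :: k, m')
      (r * (step_time + 3) + 2 + t) (iter r (step_op (tau + theta)) g X').
  apply: (value_le (t := (2 * 1 + 1 + (N * (step_time + 3) + 2 + t).+1).+1)%N).
    by rewrite /stage_time; lia.
  apply/value_seq/value_block => //; apply/value_seq/(loop _ 0%N) => //.
  case: (Hm) => *; split => //=; rewrite /upd /= ?(stX10 Hm) ?(stX9 Hm) //.
  by rewrite (stN1 Hm).
elim: r s m' X' => [|r IH] s m' X' Hs Hm'.
  rewrite mul0n; apply: value_while_false.
    by rewrite /= (stX11 Hm') (stX8 Hm') ler_nat; lia.
  apply: value_do => //; apply: Hk; rewrite addn0 in Hs; rewrite -Hs.
  case: (Hm') => *; split => //=; rewrite /upd /= ?(stN4 Hm') ?(stN1 Hm') ?addn1 //.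
apply: (value_le (t := (step_time + (r * (step_time + 3) + 2 + t).+1).+2)%N); first by lia.
apply: value_while_true; first by rewrite /= (stX11 Hm') (stX8 Hm') ler_nat; lia.
apply/value_seq; rewrite iterS; apply: (value_glauber_step Hm') => m2 X2 Hm2.
apply: value_do => //; apply: (IH s.+1); first by lia.
case: (Hm2) => *; split => //=; rewrite /upd /= ?(stX11 Hm2) ?(stX3 Hm2) //.
by rewrite [in RHS]mulrSr.
Qed.

End Correctness.

Lemma binary_length_exists (R : realType) (Q : R) :
  exists l, forall s, (2 ^+ s <= Q) = (s < l)%N.
Proof.
have [N QN] : exists N, Q < 2 ^+ N.
  exists (Num.truncn (Num.max Q 0)).+1.
  have Q0 : 0 <= Num.max Q 0 by rewrite le_max lexx orbT.
  have /andP[_ H] := truncn_itv Q0.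
  have QM : Q <= Num.max Q 0 by rewrite le_max lexx.
  apply: le_lt_trans QM (lt_trans H _).
  by rewrite -natrX ltr_nat ltn_expl.
have ex : exists N, Q < 2 ^+ N by exists N.
exists (ex_minn ex); case: ex_minnP => l Ql lmin s.
apply/idP/idP => H; last by rewrite leNgt; apply/negP => /lmin; lia.
rewrite ltnNge; apply/negP => ls; suff : Q < Q by rewrite ltxx.
by apply: lt_le_trans Ql (le_trans _ H); rewrite ler_weXn2l // ler1n.
Qed.

Section Anneal.
Variables (R : realType) (n : nat) (e : rel 'I_n) (F : config R -> R).
Variables (l kappa N : nat) (theta : R).

(** With [s] stages done and [r] to go; the next stage to run is the outermost operator. *)
Fixpoint anneal (r s : nat) (g : {set 'I_n} -> R) : {set 'I_n} -> R :=
  if r is r'.+1 then iter N (step_op e l kappa (s.+1%:R * theta)) (anneal r' s.+1 g)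
  else g.

Hypothesis kappaP : forall s, (2 ^ s <= n)%N = (s < kappa)%N.

Lemma value_anneal k m r s j X t g : (s + r = n)%N ->
  state l N theta m s.+1 (s%:R * theta) j X ->
  (forall m' j' X', state l N theta m' n.+1 (n%:R * theta) j' X' -> value e F (k, m') t (g X')) ->
  value e F (While (NLe 4 0) glauber_stage :: k, m)
    (r * (stage_time n l N kappa + 1) + 1 + t) (anneal r s g X).
Proof.
move=> Hs Hm Hk; elim: r s m j X Hs Hm => [|r IH] s m j X Hs Hm.
  rewrite mul0n add0n; apply: value_while_false.
    by rewrite /= (stN4 Hm) (stN0 Hm); lia.
  by rewrite addn0 in Hs; subst s; apply: Hk Hm.
apply: (value_le (t := (stage_time n l N kappa
  + (r * (stage_time n l N kappa + 1) + 1 + t)).+1)%N); first by lia.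
apply: value_while_true; first by rewrite /= (stN4 Hm) (stN0 Hm); lia.
have Et : s.+1%:R * theta = s%:R * theta + theta by rewrite mulrSr mulrDl mul1r.
rewrite /= Et; apply: (value_glauber_stage kappaP Hm) => m' X' Hm'.
by apply: (IH s.+1); [lia | rewrite Et; exact: Hm'].
Qed.

End Anneal.

Section Program.
Variables (R : realType) (n : nat) (e : rel 'I_n) (lambda eps delta : R).
Variables (l kappa : nat).
Hypothesis kappaP : forall s, (2 ^ s <= n)%N = (s < kappa)%N.
Hypothesis lP : forall s, (2 ^+ s <= n%:R * n%:R / delta) = (s < l)%N.

Definition threshold_step : R := lambda / (1 + lambda) * 2 ^+ l / n%:R.

Definition program_time : nat :=
  (n * (stage_time n l (n * n * l) kappa + 1) + 6 * l + 50)%N.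

Lemma value_annealed_glauber (F : config R -> R) (g : {set 'I_n} -> R) :
  (forall m, F ([::], m) = g (output n ([::], m))) ->
  value e F (init n lambda eps delta annealed_glauber) program_time
    (anneal e l kappa (n * n * l) threshold_step n 0 g finset.set0).
Proof.
move=> HF; rewrite /init.
apply: (value_le (t := (2 * 6 + 1 + (5 * l + 1 + (2 * 7 + 1 + (n *
  (stage_time n l (n * n * l) kappa + 1) + 1 + 2).+1).+1).+1).+1)%N).
  by rewrite /program_time; lia.
apply/value_seq/value_block => //; set m1 := foldl _ _ _; apply: value_seq.
set p1 := block _ _; set k1 := [:: _].
(* After [s] rounds X[6] is 2 ^ s, and [lP] ends the loop at s = l. *)
suff loop r s m : (s + r = l)%N -> nreg m 3%N = s -> rreg m 6%N = 2 ^+ s ->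
    (forall i, i != 3%N -> nreg m i = nreg m1 i) ->
    (forall i, i != 6%N -> rreg m i = rreg m1 i) ->
    value e F (While (RLe 6 5) p1 :: k1, m)
      (5 * r + 1 + (2 * 7 + 1 + (n * (stage_time n l (n * n * l) kappa + 1) + 1 + 2).+1).+1)
      (anneal e l kappa (n * n * l) threshold_step n 0 g finset.set0).
  by apply: (loop _ 0%N).
have H1 : nreg m1 1%N = 1%N by [].
have H5 : rreg m1 5%N = n%:R * n%:R / delta by [].
elim: r s m => [|r IH] s m Hs H3 H6 HN HX.
  have {}Hs : s = l by lia.
  rewrite muln0; apply: value_while_false.
    by rewrite /= H6 HX // H5 Hs lP ltnn.
  apply: value_seq; apply: value_block => //; apply: value_seq; set m2 := foldl _ _ _.
  have Hm2 : state l (n * n * l) threshold_step m2 1 (0%:R * threshold_step) 0 (finset.set0 : {set 'I_n}).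
    have E0 : nreg m 0%N = n by rewrite HN.
    have E1 : nreg m 1%N = 1%N by rewrite HN.
    have E2 : nreg m 2%N = 16%N by rewrite HN.
    have X0 : rreg m 0%N = lambda by rewrite HX.
    have X3 : rreg m 3%N = 1 by rewrite HX.
    have X4 : rreg m 4%N = n%:R by rewrite HX.
    have X10 : rreg m 10%N = 0 by rewrite HX.
    have X11 : rreg m 11%N = 0 by rewrite HX.
    split; rewrite /m2 /= /upd /= ?mul0r // ?H3 ?Hs ?X4 ?natrM //.
    - by rewrite X0 X3 H6 Hs.
    - by move=> u; rewrite HN // inE.
  apply: (value_anneal kappaP _ Hm2); first by rewrite add0n.
  move=> m3 j X Hm3; apply: value_do => //.
  apply: (value_le (t := 0%N)) => //.
  have -> : g X = F ([::], exec e false (NConst 0 16) m3); last exact: value_halt.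
  rewrite HF; congr g; apply/setP => u; rewrite inE /= /upd /= (stA Hm3).
  by case: (u \in X).
apply: (value_le (t := (2 * 1 + 1 + (5 * r + 1 + (2 * 7 + 1 + (n *
  (stage_time n l (n * n * l) kappa + 1) + 1 + 2).+1).+1)).+1)%N); first by lia.
apply: value_while_true; first by rewrite /= H6 HX // H5 lP; lia.
apply: value_block => //; apply: (IH s.+1); rewrite /= /upd /=.
- by lia.
- by rewrite H3 HN // H1 addn1.
- by rewrite H6 exprS; ring.
- by move=> i i3; rewrite (negbTE i3) HN.
- by move=> i i6; rewrite (negbTE i6) HX // /m1 /= /upd (negbTE i6).
Qed.

End Program.

(** * Coupled Glauber dynamics *)

Section UpdateOperator.
Variables (R : realType) (n M : nat) (S : Type) (act : S -> 'I_n -> bool -> S) (p : R).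
Implicit Types (g h : S -> R).

(* The Markov operator of the chain which picks each of the n vertices with
   probability 1 / M, stays put otherwise, and draws a bit with bias p. *)
Definition update_op g (s : S) : R :=
  (\sum_w (p * g (act s w true) + (1 - p) * g (act s w false)) +
   (M%:R - n%:R) * g s) / M%:R.

Lemma update_op_lin a b g h s :
  update_op (fun s => a * g s + b * h s) s = a * update_op g s + b * update_op h s.
Proof.
rewrite /update_op !(mulrA _ _ M%:R^-1) -mulrDl; congr (_ / _).
rewrite 2!(mulrDr _ (\sum_w _)) !mulr_sumr addrACA -big_split /=; congr (_ + _); last ring.
by apply: eq_bigr => w _; ring.
Qed.

Lemma iter_update_op_lin t a b g h s :
  iter t update_op (fun s => a * g s + b * h s) s =
  a * iter t update_op g s + b * iter t update_op h s.
Proof.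
elim: t s => //= t IH s; rewrite -update_op_lin; congr (update_op _ s).
by apply: funext => {}s; exact: IH.
Qed.

Hypotheses (p01 : 0 <= p <= 1) (nM : (n <= M)%N).

Lemma update_op_le g h : (forall s, g s <= h s) -> forall s, update_op g s <= update_op h s.
Proof.
case/andP: p01 => p0 p1 gh s; rewrite ler_wpM2r ?invr_ge0 ?ler0n // lerD //.
  by apply: ler_sum => w _; rewrite lerD // ler_wpM2l // subr_ge0.
by rewrite ler_wpM2l // subr_ge0 ler_nat.
Qed.

Lemma iter_update_op_le t g h :
  (forall s, g s <= h s) -> forall s, iter t update_op g s <= iter t update_op h s.
Proof. by move=> gh; elim: t => //= t IH; exact: update_op_le. Qed.

Hypothesis M0 : (0 < M)%N.

Lemma update_op_cst c s : update_op (fun=> c) s = c.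
Proof.
rewrite /update_op (eq_bigr (fun=> c)) => [|w _]; last by ring.
rewrite sumr_const card_ord -[c *+ n]mulr_natl -mulrDl [n%:R + _]addrC subrK mulrAC divff ?mul1r //.
by rewrite pnatr_eq0 -lt0n.
Qed.

Lemma iter_update_op_cst t c s : iter t update_op (fun=> c) s = c.
Proof.
elim: t s => //= t IH s; rewrite -[RHS](update_op_cst c s); congr (update_op _ s).
exact: funext.
Qed.

Lemma iter_update_op01 t g :
  (forall s, 0 <= g s <= 1) -> forall s, 0 <= iter t update_op g s <= 1.
Proof.
move=> g01 s; apply/andP; split.
  rewrite -[leLHS](iter_update_op_cst t 0 s).
  by apply: iter_update_op_le => u; case/andP: (g01 u).
rewrite -[leRHS](iter_update_op_cst t 1 s).
by apply: iter_update_op_le => u; case/andP: (g01 u).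
Qed.

(** The chain cannot leave a set of states closed under all moves; this will show that the output is
    independent. *)
Lemma update_op_eq0 (P : S -> Prop) g :
  (forall s w b, P s -> P (act s w b)) -> (forall s, P s -> g s = 0) ->
  forall s, P s -> update_op g s = 0.
Proof.
move=> Pact g0 s Ps; rewrite /update_op g0 // mulr0 addr0 big1 ?mul0r // => w _.
by rewrite !g0 ?mulr0 ?addr0 //; exact: Pact.
Qed.

Lemma iter_update_op_eq0 (P : S -> Prop) t g :
  (forall s w b, P s -> P (act s w b)) -> (forall s, P s -> g s = 0) ->
  forall s, P s -> iter t update_op g s = 0.
Proof. by move=> Pact g0; elim: t => //= t IH; exact: update_op_eq0. Qed.

End UpdateOperator.

Lemma in_update n (e : rel 'I_n) X w b u :
  (u \in update e X w b) = if u == w then b && ~~ blocked e X w else u \in X.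
Proof.
rewrite /update; have [->|uw] := eqVneq u w.
  by case: ifP => _; rewrite ?setU11 ?setD11.
by case: ifP => _; rewrite !inE (negbTE uw).
Qed.

(** * Contraction of the Hamming distance and mixing *)

Section Coupling.
Variables (R : realType) (n M : nat) (e : rel 'I_n) (p rho : R).
Hypotheses (e_sym : symmetric e) (p01 : 0 <= p <= 1) (rho01 : 0 <= rho <= 1).
Hypotheses (nM : (n <= M)%N) (M0 : (0 < M)%N).
Notation set_pair := ({set 'I_n} * {set 'I_n})%type.
Implicit Types (X Y : {set 'I_n}) (g : {set 'I_n} -> R).

Definition pair_update (s : set_pair) (w : 'I_n) (b : bool) : set_pair :=
  (update e s.1 w b, update e s.2 w b).

Definition hamming (s : set_pair) : R := \sum_u ((u \in s.1) (+) (u \in s.2))%:R.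

Definition free_neighbors X (v : 'I_n) : nat := #|[set w | e v w && ~~ blocked e X w]|.

(** For p = lam / (1 + lam) with lam > 0, some vertex has more than (1 - rho) (1 + lam) / lam
    unblocked neighbours; [rho] is the contraction margin. *)
Definition bad X : bool := [exists v, 1 - rho < p * (free_neighbors X v)%:R].

Lemma hamming_ge0 s : 0 <= hamming s.
Proof. by apply: sumr_ge0. Qed.

Lemma hamming_le s : hamming s <= n%:R.
Proof.
rewrite -[X in _ <= X%:R]card_ord -sumr_const; apply: ler_sum => u _.
by rewrite lern1 leq_b1.
Qed.

Lemma hamming_ge1 X Y : X != Y -> 1 <= hamming (X, Y).
Proof.
move=> XY; have /existsP[u uXY] : [exists u, (u \in X) (+) (u \in Y)].
  apply: contraR XY => /existsPn H; apply/eqP/setP => u.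
  by have := H u; case: (u \in X); case: (u \in Y).
by rewrite /hamming (bigD1 u) //= uXY lerDl sumr_ge0.
Qed.

(** Both copies share vertex and bit, so only the status of [w] changes: afterwards they disagree
    there only if the bit is set and exactly one copy blocks [w]. *)
Lemma hamming_update s w b : hamming (pair_update s w b) =
  hamming s - ((w \in s.1) (+) (w \in s.2))%:R +
  (b && (blocked e s.1 w (+) blocked e s.2 w))%:R.
Proof.
rewrite /hamming (bigD1 w) //= [in RHS](bigD1 w) //= !in_update eqxx.
rewrite [X in X - _]addrC addrK addrC; congr (_ + _).
  by apply: eq_bigr => u uw; rewrite !in_update (negbTE uw).
by case: b => //=; case: blocked; case: blocked.
Qed.

(** A vertex blocked in [X] but not in [Y] has a neighbour [v] in X minus Y, and is a free neighbour
    of [v] with respect to [Y]. Counting such pairs by [v], each [v] contributes at most 1 - rho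
    after multiplication by [p]. *)
Lemma sum_blocked_diff X Y : ~~ bad Y ->
  p * \sum_w (blocked e X w && ~~ blocked e Y w)%:R <=
  (1 - rho) * \sum_v ((v \in X) && (v \notin Y))%:R.
Proof.
move=> /existsPn goodY; case/andP: p01 => p0 _.
apply: (@le_trans _ _
  (p * \sum_v ((v \in X) && (v \notin Y))%:R * (free_neighbors Y v)%:R)).
  rewrite ler_wpM2l //.
  apply: (@le_trans _ _ (\sum_w \sum_v ((v \in X) && (v \notin Y))%:R *
    (e v w && ~~ blocked e Y w)%:R)).
    apply: ler_sum => w _; have [/andP[/existsP[v /andP[ewv vX]] nY]|_] := boolP (_ && _);
      last by apply: sumr_ge0 => v _; rewrite mulr_ge0.
    have vY : v \notin Y by apply: contra nY => vY; apply/existsP; exists v; rewrite ewv.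
    rewrite (bigD1 v) //= vX vY e_sym ewv nY mulr1 lerDl.
    by apply: sumr_ge0 => u _; rewrite mulr_ge0.
  rewrite exchange_big /=; apply: ler_sum => v _; rewrite -mulr_sumr ler_wpM2l //.
  rewrite /free_neighbors -sum1dep_card natr_sum [leRHS]big_mkcond /=.
  by apply: ler_sum => w _; case: ifP.
rewrite !mulr_sumr; apply: ler_sum => v _; rewrite mulrCA [X in _ <= X]mulrC.
by rewrite ler_wpM2l // leNgt goodY.
Qed.

(** The expected change in one step is (p B - d) / M, where [B] counts the vertices blocked in
    exactly one copy. *)
Lemma coupling_contraction s :
  update_op M pair_update p hamming s <=
  (1 - rho / M%:R) * hamming s + ((bad s.1)%:R + (bad s.2)%:R).
Proof.
case: s => X Y /=; case/andP: p01 => p0 p1; case/andP: rho01 => r0 r1.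
have Mpos : 0 < M%:R :> R by rewrite ltr0n.
set d := hamming _.
set B := \sum_w (blocked e X w (+) blocked e Y w)%:R : R.
have -> : update_op M pair_update p hamming (X, Y) = d + (p * B - d) / M%:R.
  rewrite /update_op (eq_bigr (fun w => d - ((w \in X) (+) (w \in Y))%:R +
    p * (blocked e X w (+) blocked e Y w)%:R)); last first.
    by move=> w _; rewrite !hamming_update /= -/d; ring.
  rewrite big_split /= sumrB sumr_const card_ord -mulr_sumr -/B.
  rewrite -[\sum_(i < n) _]/d -[d *+ n]mulr_natl -/d; field; exact: lt0r_neq0.
have dn : d <= M%:R by apply: le_trans (hamming_le _) _; rewrite ler_nat.
have d0 : 0 <= d := hamming_ge0 _.
have Bn : B <= M%:R.
  apply: (@le_trans _ _ n%:R); last by rewrite ler_nat.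
  rewrite -[X in _ <= X%:R]card_ord -sumr_const; apply: ler_sum => u _.
  by rewrite lern1 leq_b1.
have B0 : 0 <= B by apply: sumr_ge0.
(* If a copy is bad, the right-hand side has an additional 1, and the crude bound p B <= M
   suffices. *)
have [good|] := boolP (~~ bad X && ~~ bad Y); last first.
  move=> H; have b1 : 1 <= (bad X)%:R + (bad Y)%:R :> R.
    by case: (bad X) H; case: (bad Y) => //= _; rewrite ?addr0 ?add0r ?lerDl.
  apply: (@le_trans _ _ ((1 - rho / M%:R) * d + 1)); last by rewrite lerD2l.
  rewrite -subr_ge0 (_ : _ - _ = ((M%:R - p * B) + (1 - rho) * d) / M%:R).
    rewrite divr_ge0 ?(ltW Mpos) // addr_ge0 //; last by rewrite mulr_ge0 // subr_ge0.
    by rewrite subr_ge0; apply: le_trans Bn; rewrite ler_piMl.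
  by field; exact: lt0r_neq0.
case/andP: good => goodX goodY; rewrite (negbTE goodX) (negbTE goodY) !addr0.
suff H : p * B <= (1 - rho) * d.
  rewrite -subr_ge0 (_ : _ - _ = ((1 - rho) * d - p * B) / M%:R).
    by rewrite divr_ge0 ?(ltW Mpos) // subr_ge0.
  by field; exact: lt0r_neq0.
(* Disagreements are split by direction; each direction is controlled by the copy lacking the
   vertex. *)
have -> : B = \sum_w (blocked e X w && ~~ blocked e Y w)%:R +
              \sum_w (blocked e Y w && ~~ blocked e X w)%:R.
  rewrite -big_split; apply: eq_bigr => w _ /=.
  by case: blocked; case: blocked; rewrite /= ?addr0 ?add0r.
have -> : d = \sum_v ((v \in X) && (v \notin Y))%:R + \sum_v ((v \in Y) && (v \notin X))%:R.
  rewrite -big_split; apply: eq_bigr => w _ /=.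
  by case: (w \in X); case: (w \in Y); rewrite /= ?addr0 ?add0r.
by rewrite !mulrDr lerD // sum_blocked_diff.
Qed.

Variables (mu pi : {set 'I_n} -> R) (K : R).
Hypotheses (mu_ge0 : forall X, 0 <= mu X) (mu1 : \sum_X mu X = 1).
Hypotheses (pi_ge0 : forall X, 0 <= pi X) (pi1 : \sum_X pi X = 1).
Hypothesis mu_le : forall X, mu X <= K * pi X.
Hypothesis stationary :
  forall g, \sum_X pi X * update_op M (update e) p g X = \sum_X pi X * g X.

Let beta : R := \sum_X pi X * (bad X)%:R.
(** The copies start independently, from [mu] and [pi]; only the updates are coupled. *)
Let Lambda (h : set_pair -> R) : R := \sum_X \sum_Y mu X * pi Y * h (X, Y).

Lemma iter_stationary t g :
  \sum_X pi X * iter t (update_op M (update e) p) g X = \sum_X pi X * g X.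
Proof. by elim: t => //= t <-; rewrite stationary. Qed.

Lemma iter_pair_fst t g s :
  iter t (update_op M pair_update p) (fun s => g s.1) s = iter t (update_op M (update e) p) g s.1.
Proof.
elim: t s => //= t IH s; rewrite /update_op !IH; congr ((_ + _) / _).
by apply: eq_bigr => w _; rewrite !IH.
Qed.

Lemma iter_pair_snd t g s :
  iter t (update_op M pair_update p) (fun s => g s.2) s = iter t (update_op M (update e) p) g s.2.
Proof.
elim: t s => //= t IH s; rewrite /update_op !IH; congr ((_ + _) / _).
by apply: eq_bigr => w _; rewrite !IH.
Qed.

Let Lambda_le h1 h2 : (forall s, h1 s <= h2 s) -> Lambda h1 <= Lambda h2.
Proof.
by move=> H; apply: ler_sum => X _; apply: ler_sum => Y _; rewrite ler_wpM2l // mulr_ge0.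
Qed.

Let Lambda_lin a b h1 h2 :
  Lambda (fun s => a * h1 s + b * h2 s) = a * Lambda h1 + b * Lambda h2.
Proof.
rewrite /Lambda !mulr_sumr -big_split; apply: eq_bigr => X _ /=.
rewrite !mulr_sumr -big_split; apply: eq_bigr => Y _ /=; ring.
Qed.

Let Lambda_fst g : Lambda (fun s => g s.1) = \sum_X mu X * g X.
Proof.
apply: eq_bigr => X _ /=; rewrite (eq_bigr (fun Y => mu X * g X * pi Y)).
  by rewrite -mulr_sumr pi1 mulr1.
by move=> Y _; ring.
Qed.

Let Lambda_snd g : Lambda (fun s => g s.2) = \sum_X pi X * g X.
Proof.
rewrite /Lambda exchange_big; apply: eq_bigr => Y _ /=.
rewrite (eq_bigr (fun X => pi Y * g Y * mu X)); first by rewrite -mulr_sumr mu1 mulr1.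
by move=> X _; ring.
Qed.

(** Contraction is applied to the last step, the innermost operator. By then [Y] still has law [pi]
    and is bad with probability [beta]; the law of [X] is still at most K pi, so [X] is bad with
    probability at most K beta. *)
Lemma coupled_hamming t : Lambda (iter t (update_op M pair_update p) hamming) <=
  (1 - rho / M%:R) ^+ t * n%:R + t%:R * ((K + 1) * beta).
Proof.
case/andP: rho01 => r0 r1.
have Mpos : 0 < M%:R :> R by rewrite ltr0n.
have rM1 : rho / M%:R <= 1.
  by rewrite ler_pdivrMr // mul1r; apply: le_trans r1 _; rewrite (ler_nat _ 1).
have rM0 : 0 <= rho / M%:R by rewrite divr_ge0 // ltW.
have beta0 : 0 <= beta by apply: sumr_ge0 => X _; rewrite mulr_ge0.
have K0 : 0 <= K * beta.
  rewrite mulr_sumr; apply: sumr_ge0 => X _; rewrite mulrA mulr_ge0 //.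
  exact: le_trans (mu_le X).
elim: t => [|t IH].
  rewrite expr0 mul1r mul0r addr0 /=.
  apply: (@le_trans _ _ (Lambda (fun=> n%:R))); first exact: Lambda_le hamming_le.
  by rewrite (Lambda_fst (fun=> n%:R)) -mulr_suml mu1 mul1r.
rewrite iterSr.
pose h s : R := (1 - rho / M%:R) * hamming s + 1 * (1 * (bad s.1)%:R + 1 * (bad s.2)%:R).
have Hh s : update_op M pair_update p hamming s <= h s.
  by rewrite /h !mul1r; exact: coupling_contraction.
apply: le_trans (Lambda_le (iter_update_op_le _ p01 nM t Hh)) _.
have -> : iter t (update_op M pair_update p) h = fun s =>
    (1 - rho / M%:R) * iter t (update_op M pair_update p) hamming s +
    1 * (1 * iter t (update_op M (update e) p) (fun X => (bad X)%:R) s.1 +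
         1 * iter t (update_op M (update e) p) (fun X => (bad X)%:R) s.2).
  apply: funext => s.
  rewrite (iter_update_op_lin M pair_update p t (1 - rho / M%:R) 1 hamming).
  rewrite (iter_update_op_lin M pair_update p t 1 1 (fun s => (bad s.1)%:R)).
  by rewrite (iter_pair_fst t (fun X => (bad X)%:R)) (iter_pair_snd t (fun X => (bad X)%:R)).
rewrite !Lambda_lin Lambda_fst Lambda_snd iter_stationary -/beta.
set x := \sum_X _; have Hx : x <= K * beta.
  rewrite /beta -(iter_stationary t (fun X => (bad X)%:R)) mulr_sumr; apply: ler_sum => X _; rewrite mulrA ler_wpM2r //.
  have b01 Y : 0 <= ((bad Y)%:R : R) <= 1 by rewrite ler0n lern1 leq_b1.
  by have /andP[] := iter_update_op01 (update e) p01 nM M0 t b01 X.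
rewrite !mul1r exprS.
apply: (@le_trans _ _ ((1 - rho / M%:R) * ((1 - rho / M%:R) ^+ t * n%:R +
   t%:R * ((K + 1) * beta)) + (K * beta + beta))).
  by rewrite lerD // ?lerD // ler_wpM2l // subr_ge0.
rewrite -subr_ge0 mulrSr (_ : _ - _ = rho / M%:R * (t%:R * (K * beta + beta))); last by ring.
by rewrite mulr_ge0 // mulr_ge0 // addr_ge0.
Qed.

(** Values of [g] at different sets differ by at most 1, hence by at most the Hamming distance. The
    sign [a] takes care of the absolute value. *)
Lemma mixing t g : (forall X, 0 <= g X <= 1) ->
  `|\sum_X mu X * iter t (update_op M (update e) p) g X - \sum_X pi X * g X| <=
  (1 - rho / M%:R) ^+ t * n%:R + t%:R * ((K + 1) * beta).
Proof.
move=> g01; apply: le_trans (coupled_hamming t).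
have H a : a = 1 \/ a = -1 -> a * (\sum_X mu X * iter t (update_op M (update e) p) g X -
    \sum_X pi X * g X) <= Lambda (iter t (update_op M pair_update p) hamming).
  move=> Ha; rewrite -(iter_stationary t) -Lambda_fst -Lambda_snd.
  set L1 := Lambda _; set L2 := Lambda _.
  rewrite (_ : a * (L1 - L2) = a * L1 + (- a) * L2); last by ring.
  rewrite -Lambda_lin; apply: Lambda_le => s.
  rewrite -iter_pair_fst -iter_pair_snd -iter_update_op_lin.
  apply: iter_update_op_le => // {}s; case: s => X Y /=.
  have [->|XY] := eqVneq X Y; first by rewrite mulNr subrr hamming_ge0.
  apply: le_trans (hamming_ge1 XY).
  by have := g01 X; have := g01 Y; case: Ha => ->; lra.
rewrite ler_norml -[X in _ && (X <= _)]mul1r H ?andbT; last by left.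
by rewrite lerNl -mulN1r H //; right.
Qed.

End Coupling.

(** * The hard-core model *)

Section Subsets.
Variables (R : realType) (I : finType).
Implicit Types (A B J : {set I}).

Lemma expr_sum_subsets A (x y : R) :
  (x + y) ^+ #|A| = \sum_(J : {set I} | J \subset A) x ^+ #|J| * y ^+ #|A :\: J|.
Proof.
pose f i := if i \in A then x else 0; pose g i := if i \in A then y else 1.
have -> : (x + y) ^+ #|A| = \prod_i (f i + g i).
  rewrite -prodr_const big_mkcond; apply: eq_bigr => i _; rewrite /f /g.
  by case: ifP; rewrite ?add0r.
rewrite bigA_distr [RHS]big_mkcond; apply: eq_big => [J|J _]; first by rewrite inE.
case: ifPn => [JA|/subsetPn[i iJ iA]]; last first.
  by rewrite (bigD1 i) //= iJ /f (negbTE iA) mul0r.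
rewrite (bigID (mem J)) /= -!prodr_const; congr (_ * _).
  by apply: eq_bigr => i iJ; rewrite iJ /f (fintype.subsetP JA).
rewrite [RHS](eq_bigl (fun i => (i \notin J) && (i \in A))); last first.
  by move=> i; rewrite inE.
by rewrite big_mkcondr; apply: eq_bigr => i /negbTE ->.
Qed.

Lemma sum_subsets A (x : R) : \sum_(J : {set I} | J \subset A) x ^+ #|J| = (1 + x) ^+ #|A|.
Proof.
by rewrite addrC expr_sum_subsets; apply: eq_bigr => J _; rewrite expr1n mulr1.
Qed.

(** Prepares conditioning on the configuration [Y] off [B]. *)
Lemma sum_split_block B (F : {set I} -> R) :
  \sum_X F X = \sum_(Y : {set I} | [disjoint Y & B]) \sum_(Z : {set I} | Z \subset B) F (Y :|: Z).
Proof.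
rewrite pair_big_dep /=.
rewrite (reindex_onto (fun p : {set I} * {set I} => p.1 :|: p.2)
  (fun X => (X :\: B, X :&: B))) /=; last by move=> X _; rewrite finset.setUC finset.setID.
apply: eq_bigl => -[Y Z] /=; apply/eqP/andP => [[YE ZE]|[YB ZB]].
  by rewrite -YE -ZE finset.subsetIr finset.disjoints_subset finset.setDE finset.subsetIr.
rewrite finset.setDUl finset.setIUl (finset.setDidPl YB) (finset.setIidPl ZB).
rewrite (disjoint_setI0 YB) finset.set0U; congr pair.
by rewrite (_ : Z :\: B = finset.set0) ?finset.setU0 //; apply/eqP; rewrite finset.setD_eq0.
Qed.

Lemma sum_subset1 w (G : {set I} -> R) :
  \sum_(Z : {set I} | Z \subset [set w]) G Z = G finset.set0 + G [set w].
Proof.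
rewrite (bigD1 finset.set0) ?finset.sub0set //=; congr (_ + _).
rewrite (big_pred1 [set w]) // => Z; rewrite subset1.
have [->|Zw] := eqVneq Z [set w]; first by rewrite -cards_eq0 cards1 /= eqxx.
by rewrite /= andbN (negbTE Zw).
Qed.

End Subsets.

Section Gibbs.
Variables (R : realType) (n : nat) (e : rel 'I_n).
Hypotheses (e_sym : symmetric e) (e_irr : irreflexive e).
Implicit Types (X Y Z : {set 'I_n}) (lambda : R).

Lemma independentP X : reflect (forall u v, u \in X -> v \in X -> ~~ e u v) (independent e X).
Proof.
apply: (iffP forall_inP) => H u.
  by move=> v uX vX; have /forall_inP := H u uX; exact.
by move=> uX; apply/forall_inP => v vX; exact: H.
Qed.

Lemma independent0 : independent e finset.set0.
Proof. by apply/independentP => u v; rewrite inE. Qed.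

Lemma independent_sub X Y : X \subset Y -> independent e Y -> independent e X.
Proof.
by move=> /fintype.subsetP XY /independentP H; apply/independentP => u v uX vX; apply: H; exact: XY.
Qed.

Lemma independentU1 w X : independent e (w |: X) = independent e X && ~~ blocked e X w.
Proof.
apply/idP/andP => [H|[/independentP HX nb]].
  split; first exact: independent_sub (finset.subsetUr _ _) H.
  apply/existsP => -[u /andP[ewu uX]]; move/independentP: H => /(_ w u).
  by rewrite !inE eqxx uX orbT ewu => /(_ isT isT).
have nw u : u \in X -> ~~ e w u.
  by move=> uX; apply: contra nb => ewu; apply/existsP; exists u; rewrite ewu.
apply/independentP => u v /setU1P[->|uX] /setU1P[->|vX].
- by rewrite e_irr.
- exact: nw.
- by rewrite e_sym; exact: nw.
- exact: HX.
Qed.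

Lemma independent_update X w b : independent e X -> independent e (update e X w b).
Proof.
move=> HX; rewrite /update; case: ifP => [/andP[_ nb]|_].
  by rewrite independentU1 HX.
exact: independent_sub (subD1set _ _) HX.
Qed.

Definition weight lambda X : R := if independent e X then lambda ^+ #|X| else 0.

Lemma weight_ge0 lambda X : 0 <= lambda -> 0 <= weight lambda X.
Proof. by rewrite /weight; case: ifP => // _ /exprn_ge0; exact. Qed.

Lemma partition_functionE lambda : partition_function e lambda = \sum_X weight lambda X.
Proof. by rewrite /partition_function big_mkcond. Qed.

Lemma partition_function_ge1 lambda : 0 <= lambda -> 1 <= partition_function e lambda.
Proof.
move=> l0; rewrite partition_functionE (bigD1 finset.set0) //= /weight independent0 cards0.
by rewrite expr0 lerDl; apply: sumr_ge0 => X _; exact: weight_ge0.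
Qed.

Lemma partition_function_gt0 lambda : 0 <= lambda -> 0 < partition_function e lambda.
Proof. by move=> /partition_function_ge1; exact: lt_le_trans. Qed.

Lemma gibbsE lambda X : gibbs e lambda X = weight lambda X / partition_function e lambda.
Proof. by rewrite /gibbs /weight; case: ifP; rewrite ?mul0r. Qed.

Lemma gibbs_ge0 lambda X : 0 <= lambda -> 0 <= gibbs e lambda X.
Proof.
by move=> l0; rewrite gibbsE divr_ge0 ?weight_ge0 // ltW // partition_function_gt0.
Qed.

Lemma sum_gibbs lambda : 0 <= lambda -> \sum_X gibbs e lambda X = 1.
Proof.
move=> l0; under eq_bigr do rewrite gibbsE.
by rewrite -mulr_suml -partition_functionE divff // gt_eqF // partition_function_gt0.
Qed.

Lemma gibbs0 X : gibbs e (0 : R) X = (X == finset.set0)%:R.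
Proof.
have w0 Y : weight 0 Y = (Y == finset.set0)%:R.
  rewrite /weight expr0n cards_eq0; case: eqVneq => [->|_]; first by rewrite independent0.
  by case: ifP.
rewrite gibbsE partition_functionE (eq_bigr _ (fun Y _ => w0 Y)) w0 (bigD1 finset.set0) //=.
by rewrite eqxx big1 ?addr0 ?divr1 // => Y /negbTE ->.
Qed.

(** Expand (lambda + h) ^ |X| over the subsets [J] of [X] and sum over [X] first: once the
    independence of [X] is dropped, the supersets of [J] contribute (1 + h) ^ (n - |J|). *)
Lemma partition_function_le lambda h : 0 <= lambda -> 0 <= h ->
  partition_function e (lambda + h) <= (1 + h) ^+ n * partition_function e lambda.
Proof.
move=> l0 h0; rewrite /partition_function mulr_sumr.
under eq_bigr do rewrite expr_sum_subsets.
rewrite (exchange_big_dep (independent e)) /=; last first.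
  by move=> X J indX JX; exact: independent_sub JX indX.
apply: ler_sum => J indJ.
rewrite -mulr_sumr mulrC ler_wpM2r ?exprn_ge0 //.
apply: (@le_trans _ _ (\sum_(X : {set 'I_n} | J \subset X) h ^+ #|X :\: J|)).
  rewrite [leRHS](bigID (independent e)) /= -[leLHS]addr0 lerD //.
    by rewrite le_eqVlt; apply/orP; left; apply/eqP/eq_bigl => X; rewrite andbC.
  by apply: sumr_ge0 => X _; exact: exprn_ge0.
rewrite (reindex_onto (fun W => J :|: W) (fun X => X :\: J)) /=; last first.
  by move=> X JX; rewrite finset.setUC finset.setDE finset.setUIl finset.setUC
    [~: J :|: J]finset.setUC finset.setUCr finset.setIT; apply/finset.setUidPr.
rewrite (eq_big (fun W : {set 'I_n} => W \subset ~: J) (fun W => h ^+ #|W|)).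
- rewrite sum_subsets ler_weXn2l ?lerDl //.
  by rewrite -[X in (_ <= X)%N]card_ord max_card.
- move=> W; rewrite finset.subsetUl finset.setDUl finset.setDv finset.set0U /=.
  by rewrite -finset.disjoints_subset; apply/eqP/idP => /finset.setDidPl.
- by move=> W /andP[_ /eqP ->].
Qed.

(** Weights increase with the fugacity, so only the ratio of partition functions is lost. *)
Lemma gibbs_le lambda1 lambda2 X : 0 <= lambda1 <= lambda2 ->
  gibbs e lambda1 X <= (1 + (lambda2 - lambda1)) ^+ n * gibbs e lambda2 X.
Proof.
case/andP=> l10 l12; have l20 := le_trans l10 l12.
have Z1 := partition_function_gt0 l10; have Z2 := partition_function_gt0 l20.
rewrite !gibbsE mulrA ler_pdivrMr // mulrAC ler_pdivlMr //.
have h0 : 0 <= lambda2 - lambda1 by rewrite subr_ge0.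
have := partition_function_le l10 h0; rewrite addrC subrK => HZ.
have Hw : weight lambda1 X <= weight lambda2 X.
  by rewrite /weight; case: ifP => // _; rewrite lerXn2r // nnegrE.
apply: le_trans (ler_wpM2l (weight_ge0 X l10) HZ) _.
rewrite mulrCA -mulrA ler_wpM2l //; first by rewrite exprn_ge0 // addr_ge0.
by rewrite ler_wpM2r // ltW.
Qed.

(** Given the rest of the configuration, an unblocked [w] is occupied with probability lambda / (1 +
    lambda), so the move resamples [w] from its conditional law. *)
Lemma vertex_stationary lambda g w : 0 <= lambda ->
  \sum_X gibbs e lambda X * (lambda / (1 + lambda) * g (update e X w true) +
    (1 - lambda / (1 + lambda)) * g (update e X w false)) =
  \sum_X gibbs e lambda X * g X.
Proof.
move=> l0; rewrite [LHS](sum_split_block [set w]) [RHS](sum_split_block [set w]).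
apply: eq_bigr => Y; rewrite disjoint_sym disjoints1 => wY.
rewrite !sum_subset1 finset.setU0 ![Y :|: _]finset.setUC.
have bw : blocked e (w |: Y) w = blocked e Y w.
  apply/existsP/existsP => -[u /andP[eu]].
    by case/setU1P=> [uw|uY]; [rewrite uw e_irr in eu | exists u; rewrite eu].
  by move=> uY; exists u; rewrite eu finset.setU1r.
have U X b : X = Y \/ X = w |: Y ->
    update e X w b = if b && ~~ blocked e Y w then w |: Y else Y.
  case=> ->; rewrite /update ?bw; case: ifP => // _.
  - by apply/finset.setDidPl; rewrite disjoint_sym disjoints1.
  - by rewrite finset.setUA finset.setUid.
  - by rewrite finset.setU1K.
rewrite !U; try by [left|right].
rewrite !gibbsE /weight independentU1 cardsU1 wY /= exprS.
have l1 : 1 + lambda != 0 by rewrite gt_eqF // ltr_pwDl.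
have Z0 : partition_function e lambda != 0 by rewrite gt_eqF // partition_function_gt0.
by case: (blocked e Y w); case: (independent e Y) => /=; field; rewrite ?l1 ?Z0.
Qed.

Lemma gibbs_stationary lambda M g : 0 <= lambda -> (0 < M)%N ->
  \sum_X gibbs e lambda X * update_op M (update e) (lambda / (1 + lambda)) g X =
  \sum_X gibbs e lambda X * g X.
Proof.
move=> l0 M0; rewrite /update_op; set S := RHS.
under eq_bigr do rewrite mulrA mulrDr mulr_sumr.
rewrite -mulr_suml big_split /= exchange_big /=.
under eq_bigr do rewrite vertex_stationary // -/S.
under [X in _ + X]eq_bigr do rewrite mulrCA.
rewrite -mulr_sumr -/S sumr_const card_ord -[S *+ n]mulr_natl; field.
by rewrite pnatr_eq0 -lt0n.
Qed.

End Gibbs.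

Definition accept_prob (R : realType) (l : nat) (tau : R) : R :=
  #|[set b : 'I_(2 ^ l) | b.+1%:R <= tau]|%:R / 2 ^+ l.

Lemma step_opE (R : realType) n (e : rel 'I_n) l kappa (tau : R) g X :
  (n <= 2 ^ kappa)%N ->
  step_op e l kappa tau g X = update_op (2 ^ kappa) (update e) (accept_prob l tau) g X.
Proof.
move=> nk; rewrite /step_op bitavgE /update_op natrX; congr (_ / _).
pose f v := bitavg l 0 (fun b => g (update_nat e X v (b.+1%:R <= tau))).
have fE v : f v = accept_prob l tau * g (update_nat e X v true) +
    (1 - accept_prob l tau) * g (update_nat e X v false).
  rewrite /f bitavgE /accept_prob.
  set N := 2 ^+ l; have N0 : N != 0 by rewrite expf_neq0 // pnatr_eq0.
  set A := [set b | _]; set y := g _; set z := g _.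
  have -> : \sum_(b < 2 ^ l) g (update_nat e X v ((0 * 2 ^ l + b).+1%:R <= tau)) =
      #|A|%:R * y + (N - #|A|%:R) * z.
    rewrite (bigID (mem A)) /=; congr (_ + _).
      rewrite (eq_bigr (fun=> y)) ?sumr_const ?mulr_natl // => b.
      by rewrite inE mul0n add0n => ->.
    rewrite (eq_bigr (fun=> z)) => [|b]; last by rewrite inE mul0n add0n => /negbTE ->.
    have -> : N - #|A|%:R = #|~: A|%:R.
      by rewrite /N -natrX -[X in X%:R - _]card_ord -(cardsC A) natrD addrC addKr.
    by rewrite mulr_natl -sumr_const; apply: eq_bigl => b; rewrite finset.in_setC.
  by field.
rewrite -(big_mkord xpredT (fun b => f (0 * 2 ^ kappa + b)%N)) (@big_cat_nat _ _ _ n) //=.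
congr (_ + _).
  rewrite big_mkord; apply: eq_bigr => w _; rewrite mul0n add0n fE.
  by rewrite /update_nat valK.
(* The numbers from n to 2 ^ kappa - 1 are no vertices and give the lazy term. *)
rewrite (eq_big_nat _ _ (F2 := fun=> g X)) => [|v /andP[nv _]].
  by rewrite sumr_const_nat -[g X *+ _]mulr_natl natrB // natrX.
rewrite mul0n add0n fE /update_nat insubF; last by rewrite ltnNge nv.
by rewrite -mulrDl addrC subrK mul1r.
Qed.

(** * Local uniformity of the Gibbs distribution *)

Section ShortCycles.
Variables (R : realType) (n : nat) (e : rel 'I_n).
Hypotheses (e_sym : symmetric e) (e_irr : irreflexive e) (girth6 : (6%:E <= girth R e)%E).

Lemma cycle_size_ge6 c : is_cycle e c -> (6 <= size c)%N.
Proof.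
move=> Hc; have /(le_trans girth6) : (girth R e <= ((size c)%:R)%:E)%E.
  by apply: ereal_inf_lbound; exists c.
by rewrite lee_fin ler_nat.
Qed.

Lemma adj_neq x y : e x y -> x != y.
Proof. by apply: contraTneq => ->; rewrite e_irr. Qed.

Lemma no_cycle3 x y z : e x y -> e y z -> e z x -> False.
Proof.
move=> xy yz zx; have /cycle_size_ge6 // : is_cycle e [:: x; y; z].
split=> //; rewrite /ucycle /= xy yz zx /= !inE !negb_or.
by rewrite (adj_neq xy) (adj_neq yz) eq_sym (adj_neq zx).
Qed.

Lemma no_cycle4 a b c d : e a b -> e b c -> e c d -> e d a -> a != c -> b = d.
Proof.
move=> ab bc cd da ac; apply/eqP/negPn/negP => bd.
have /cycle_size_ge6 // : is_cycle e [:: a; b; c; d].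
split=> //; rewrite /ucycle /= ab bc cd da /= !inE !negb_or.
rewrite (adj_neq ab) (adj_neq bc) (adj_neq cd) bd ac /=.
by rewrite eq_sym (adj_neq da).
Qed.

(** If two vertices at distance two along the walk coincided, a triangle would remain; so the walk
    is a cycle. *)
Lemma no_cycle5 a b c d f : e a b -> e b c -> e c d -> e d f -> e f a -> False.
Proof.
move=> ab bc cd df fa.
have ac : a != c by apply/eqP => ac; subst c; exact: no_cycle3 cd df fa.
have bd : b != d by apply/eqP => bd; subst d; exact: no_cycle3 df fa ab.
have cf : c != f by apply/eqP => cf; subst f; exact: no_cycle3 ab bc fa.
have da : d != a by apply/eqP => da; subst d; exact: no_cycle3 ab bc cd.
have fb : f != b by apply/eqP => fb; subst f; exact: no_cycle3 bc cd df.
have /cycle_size_ge6 // : is_cycle e [:: a; b; c; d; f].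
split=> //; rewrite /ucycle /= ab bc cd df fa /= !inE !negb_or.
rewrite (adj_neq ab) (adj_neq bc) (adj_neq cd) (adj_neq df) ac bd cf /=.
by rewrite [a == d]eq_sym da [b == f]eq_sym fb [a == f]eq_sym (adj_neq fa).
Qed.

End ShortCycles.

(** * Concentration of the number of free neighbours *)

Section LocalUniformity.
Variables (R : realType) (n : nat) (e : rel 'I_n) (lambda : R).
Hypotheses (e_sym : symmetric e) (e_irr : irreflexive e).
Hypotheses (no3 : forall x y z, e x y -> e y z -> e z x -> False).
Hypotheses (no4 : forall a b c d, e a b -> e b c -> e c d -> e d a -> a != c -> b = d).
Hypotheses (no5 : forall a b c d f, e a b -> e b c -> e c d -> e d f -> e f a -> False).
Hypothesis lambda_ge0 : 0 <= lambda.
Implicit Types (X Y Z : {set 'I_n}) (v w x : 'I_n).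

(** Here [v] is the parent of [w], and the other neighbours of [w] are its children; the state of
    the parent is disregarded. *)
Definition free X v w : bool := [forall x, e w x && (x \in X) ==> (x == v)].

Definition free_children X v w : {set 'I_n} := [set x | [&& e w x, x != v & free X w x]].

(* The conditional probability, given the configuration off w and its children,
   that no child of w is occupied; the parent of w is v. *)
Definition free_prob X v w : R :=
  let s := if v \in X then 0 else lambda in
  (1 + s) / ((1 + lambda) ^+ #|free_children X v w| + s).

Definition deviation v w X : R := (free X v w)%:R - free_prob X v w.

Definition star v w : {set 'I_n} := [set x | (x == w) || (e w x && (x != v))].

(** Measurability with respect to the configuration off [B]. *)
Definition invariant (T : Type) (B : {set 'I_n}) (G : {set 'I_n} -> T) : Prop :=
  forall X Y, X :\: B = Y :\: B -> G X = G Y.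

Lemma mem_off B X Y y : X :\: B = Y :\: B -> y \notin B -> (y \in X) = (y \in Y).
Proof. by move=> /setP/(_ y) H yB; move: H; rewrite !inE yB. Qed.

Lemma free_invariant (B : {set 'I_n}) v w : (forall y, e w y -> y != v -> y \notin B) ->
  invariant B (fun X => free X v w).
Proof.
move=> HB X Y XY; apply: eq_forallb => y; have [->|yv] := eqVneq y v; first by rewrite !implybT.
by case wy : (e w y) => //=; rewrite (mem_off XY) // HB.
Qed.

Lemma free_prob_invariant (B : {set 'I_n}) v w : v \notin B ->
  (forall x y, e w x -> x != v -> e x y -> y != w -> y \notin B) ->
  invariant B (fun X => free_prob X v w).
Proof.
move=> vB HB X Y XY; rewrite /free_prob (mem_off XY vB).
rewrite (_ : free_children X v w = free_children Y v w) //.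
apply/setP => x; rewrite !inE; case wx : (e w x) => //=; case xv : (x != v) => //=.
by apply: (free_invariant (B := B)) XY => y; exact: HB.
Qed.

Lemma parent_notin_star v w : e v w -> v \notin star v w.
Proof.
by move=> vw; rewrite inE eqxx andbF orbF; apply: contraTneq vw => ->; rewrite e_irr.
Qed.

(** [free_prob] depends only on [v] and the grandchildren of [w]; a grandchild that is also a child
    would close a triangle. *)
Lemma free_prob_star v w : e v w -> invariant (star v w) (fun X => free_prob X v w).
Proof.
move=> vw; apply: free_prob_invariant; first exact: parent_notin_star.
move=> x y wx xv xy yw; rewrite inE negb_or yw negb_and.
by apply/orP; left; apply/negP => wy; apply: no3 wx xy _; rewrite e_sym.
Qed.

(** Here girth 6 is used in full: if a child or grandchild of [w'] met the star of its sibling [w],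
    there would be a cycle of length 3, 4 or 5 through [v]. *)
Lemma deviation_star v w w' : e v w -> e v w' -> w' != w ->
  invariant (star v w) (deviation v w').
Proof.
move=> vw vw' w'w X Y XY; congr ((nat_of_bool _)%:R - _).
  apply: (free_invariant (B := star v w)) XY => y w'y yv; rewrite inE negb_or negb_and yv orbF.
  apply/andP; split.
    by apply/eqP => yw; subst y; apply: (no3 vw' w'y); rewrite e_sym.
  apply/negP => wy; move/eqP: w'w; apply; apply: (no4 vw' w'y) => //.
  - by rewrite e_sym.
  - by rewrite e_sym.
  - by rewrite eq_sym.
apply: (free_prob_invariant (B := star v w)) XY; first exact: parent_notin_star.
move=> x y w'x xv xy yw'; rewrite inE negb_or negb_and; apply/andP; split.
  apply/eqP => yw; subst y; move/eqP: w'w; apply; apply: (no4 vw' w'x) => //.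
  - by rewrite e_sym.
  - by rewrite eq_sym.
apply/orP; left; apply/negP => wy.
by apply: (no5 vw' w'x xy (_ : e y w) _); rewrite e_sym.
Qed.

(** With [Y] fixed off the star, the only [Z] of nonzero weight are sets of free children, which are
    pairwise non-adjacent for lack of triangles, and {w} if [v] is unoccupied. Among these, [w] is
    free exactly for the empty set and {w}. *)
Lemma deviation_weight v w Y Z : e v w -> [disjoint Y & star v w] -> Z \subset star v w ->
  weight e lambda (Y :|: Z) * deviation v w (Y :|: Z) =
  weight e lambda Y *
    ((Z \subset free_children Y v w)%:R * (lambda ^+ #|Z| *
       ((Z == finset.set0)%:R - free_prob Y v w)) +
     (Z == [set w])%:R * ((if v \in Y then 0 else lambda) * (1 - free_prob Y v w))).
Proof.
move=> vw YB ZB; rewrite /deviation.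
have YZ : (Y :|: Z) :\: star v w = Y :\: star v w.
  by rewrite finset.setDUl (_ : Z :\: _ = finset.set0) ?finset.setU0 //; apply/eqP;
     rewrite finset.setD_eq0.
rewrite (free_prob_star vw YZ).
have Yoff y : y \in Y -> y \notin star v w by move=> yY; rewrite (disjointFr YB yY).
have wY : w \notin Y by apply/negP => /Yoff; rewrite inE eqxx.
have chY y : y \in Y -> e w y -> y = v.
  by move=> /Yoff; rewrite inE negb_or => /andP[_] /[swap] -> /=; rewrite negbK => /eqP.
have wA : w \notin free_children Y v w by rewrite inE e_irr.
have cardYZ : #|Y :|: Z| = (#|Y| + #|Z|)%N.
  rewrite cardsU (_ : Y :&: Z = finset.set0) ?cards0 ?subn0 //.
  apply/setP => y; rewrite !inE; apply/negP => /andP[/Yoff H] /(fintype.subsetP ZB).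
  by rewrite (negbTE H).
have bY : blocked e Y w = (v \in Y).
  apply/existsP/idP => [[u /andP[wu uY]]|vY]; first by rewrite -(chY u uY wu).
  by exists v; rewrite e_sym vw.
have [->|Zw] := eqVneq Z [set w].
  rewrite finset.sub1set (negbTE wA) mul0r add0r mul1r finset.setUC /weight independentU1 // bY.
  have -> : free (w |: Y) v w.
    apply/forallP => x; apply/implyP => /andP[wx /setU1P[xw|xY]].
      by rewrite xw e_irr in wx.
    by apply/eqP/chY.
  rewrite cardsU1 wY exprS; case: (v \in Y); case: (independent e Y) => /=; ring.
rewrite mul0r addr0.
have [wZ|wZ] := boolP (w \in Z).
  have [z zZ zw] : exists2 z, z \in Z & z != w.
    apply/exists_inP; apply: contraR Zw => /exists_inPn H; apply/eqP/setP => z.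
    rewrite inE; apply/idP/eqP => [zZ|-> //]; by apply/eqP/negPn/H.
  have wz : e w z.
    by have := fintype.subsetP ZB z zZ; rewrite inE (negbTE zw) => /andP[].
  have -> : weight e lambda (Y :|: Z) = 0.
    rewrite /weight ifF //; apply/negP => /independentP/(_ w z).
    by rewrite !inE wZ zZ !orbT wz => /(_ isT isT).
  have -> : (Z \subset free_children Y v w) = false.
    by apply/negP => /fintype.subsetP/(_ w wZ); rewrite (negbTE wA).
  by rewrite !mul0r mulr0.
have ZC z : z \in Z -> e w z && (z != v).
  move=> zZ; have := fintype.subsetP ZB z zZ; rewrite inE => /orP[/eqP zw|//].
  by rewrite -zw zZ in wZ.
have -> : free (Y :|: Z) v w = (Z == finset.set0).
  apply/forallP/eqP => [H|-> x].
    apply/setP => z; rewrite inE; apply/negP => zZ; have /andP[wz zv] := ZC z zZ.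
    by have := H z; rewrite wz inE zZ orbT (negbTE zv).
  rewrite finset.setU0; apply/implyP => /andP[wx xY]; apply/eqP; exact: chY.
have -> : weight e lambda (Y :|: Z) =
    weight e lambda Y * ((Z \subset free_children Y v w)%:R * lambda ^+ #|Z|).
  rewrite /weight (_ : independent e (Y :|: Z) =
    independent e Y && (Z \subset free_children Y v w)).
    rewrite cardYZ exprD.
    by case: (independent e Y); case: (_ \subset _) => /=; rewrite ?mul1r ?mul0r ?mulr0.
  apply/independentP/andP => [H|[/independentP HY ZA]].
    split.
      by apply/independentP => a b aY bY'; apply: H; rewrite inE ?aY ?bY'.
    apply/fintype.subsetP => z zZ; rewrite inE; have /andP[-> ->] /= := ZC z zZ.
    apply/forallP => y; apply/implyP => /andP[zy yY].
    by have := H z y; rewrite !inE zZ yY orbT zy => /(_ isT isT).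
  have HYZ a z : a \in Y -> z \in Z -> ~~ e z a.
    move=> aY zZ; apply/negP => za.
    have := fintype.subsetP ZA z zZ; rewrite inE => /and3P[_ _ /forallP/(_ a)].
    by rewrite za aY /= => /eqP aw; rewrite -aw aY in wY.
  move=> a b /setUP[aY|aZ] /setUP[bY'|bZ].
  - exact: HY.
  - by rewrite e_sym; exact: HYZ.
  - exact: HYZ.
  - have /andP[wa _] := ZC a aZ; have /andP[wb _] := ZC b bZ.
    by apply/negP => ab; apply: no3 wa ab _; rewrite e_sym.
ring.
Qed.

(** Given the configuration off the star, the deviation has mean zero: the inner sum is 1 - q (1 +
    lambda) ^ |A| + s (1 - q), and [free_prob] is the root [q]. *)
Lemma sum_deviation v w (G : {set 'I_n} -> R) : e v w -> invariant (star v w) G ->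
  \sum_X weight e lambda X * deviation v w X * G X = 0.
Proof.
move=> vw HG; rewrite (sum_split_block (star v w)); apply: big1 => Y YB.
rewrite (eq_bigr (fun Z : {set 'I_n} => weight e lambda Y * G Y *
    ((Z \subset free_children Y v w)%:R * (lambda ^+ #|Z| *
       ((Z == finset.set0)%:R - free_prob Y v w)) +
     (Z == [set w])%:R * ((if v \in Y then 0 else lambda) * (1 - free_prob Y v w))))); last first.
  move=> Z ZB; rewrite deviation_weight // (HG (Y :|: Z) Y); first by ring.
  by rewrite finset.setDUl (_ : Z :\: _ = finset.set0) ?finset.setU0 //; apply/eqP;
     rewrite finset.setD_eq0.
rewrite -mulr_sumr; apply/eqP; rewrite mulf_eq0; apply/orP; right; apply/eqP.
set A := free_children Y v w; set q := free_prob Y v w; set s := if _ then _ else _.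
rewrite big_split /=.
have AB : A \subset star v w.
  by apply/fintype.subsetP => x; rewrite !inE => /and3P[-> -> _]; rewrite orbT.
have -> : \sum_(Z : {set 'I_n} | Z \subset star v w) (Z == [set w])%:R * (s * (1 - q)) = s * (1 - q).
  rewrite (bigD1 [set w]) /=; last by rewrite finset.sub1set inE eqxx.
  by rewrite eqxx mul1r big1 ?addr0 // => Z /andP[_ /negbTE ->]; rewrite mul0r.
have -> : \sum_(Z : {set 'I_n} | Z \subset star v w)
    (Z \subset A)%:R * (lambda ^+ #|Z| * ((Z == finset.set0)%:R - q)) =
    \sum_(Z : {set 'I_n} | Z \subset A) lambda ^+ #|Z| * ((Z == finset.set0)%:R - q).
  rewrite [RHS]big_mkcond [LHS]big_mkcond /=; apply: eq_bigr => Z _.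
  case: ifPn => ZB; first by case: ifP; rewrite ?mul1r ?mul0r.
  by rewrite ifN //; apply: contra ZB => ZA; apply: fintype.subset_trans AB.
under eq_bigr do rewrite mulrBr.
rewrite sumrB -mulr_suml sum_subsets (bigD1 finset.set0) ?finset.sub0set //=.
rewrite eqxx cards0 expr0 mulr1 big1 ?addr0 => [|Z /andP[_ /negbTE ->]]; last by rewrite mulr0.
rewrite /q /free_prob -/A -/s.
have b1 : 1 <= (1 + lambda) ^+ #|A| by rewrite exprn_ege1 // lerDl.
have s0 : 0 <= s by rewrite /s; case: ifP.
by field; rewrite gt_eqF // ltr_pwDl // (lt_le_trans ltr01).
Qed.

(** The factors of the siblings do not depend on the star of [w], so by [sum_deviation] the term in
    [theta] of the factor of [w] vanishes. Factors drop out one by one, as for independent centred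
    variables. *)
Lemma sum_prod_deviation v theta (r : seq 'I_n) : uniq r -> all (e v) r ->
  \sum_X weight e lambda X * \prod_(w <- r) (1 + theta * deviation v w X) =
  partition_function e lambda.
Proof.
rewrite partition_functionE; elim: r => [|w r IH] /=.
  by move=> _ _; apply: eq_bigr => X _; rewrite big_nil mulr1.
case/andP=> wr Ur /andP[vw er]; rewrite -{}IH //.
set G := fun X => \prod_(w <- r) (1 + theta * deviation v w X).
transitivity (\sum_X (weight e lambda X * G X +
    theta * (weight e lambda X * deviation v w X * G X))).
  by apply: eq_bigr => X _; rewrite big_cons -/(G X); ring.
rewrite big_split /= -mulr_sumr sum_deviation // ?mulr0 ?addr0 //.
move=> X Y XY; rewrite /G !big_seq; apply: eq_bigr => w' w'r.
by rewrite (deviation_star vw (allP er w' w'r) _ XY) //; apply: contraNneq wr => <-.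
Qed.

Lemma free_prob_ge0 X v w : 0 <= free_prob X v w.
Proof.
rewrite /free_prob; case: ifP => _; rewrite divr_ge0 ?addr_ge0 //;
  by rewrite exprn_ge0 // addr_ge0.
Qed.

Lemma free_prob_le1 X v w : free_prob X v w <= 1.
Proof.
have b1 : 1 <= (1 + lambda) ^+ #|free_children X v w| by rewrite exprn_ege1 // lerDl.
rewrite /free_prob; set s := if _ then _ else _.
have s0 : 0 <= s by rewrite /s; case: ifP.
by rewrite ler_pdivrMr ?mul1r ?lerD2r // ltr_pwDl // (lt_le_trans ltr01).
Qed.

Lemma norm_deviation v w X : `|deviation v w X| <= 1.
Proof.
rewrite /deviation; have := free_prob_ge0 X v w; have := free_prob_le1 X v w.
by case: (free X v w); rewrite ler_norml /=; lra.
Qed.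

(** After multiplication by exp(2 x ^ 2 - x), which is at least 1 - x + 2 x ^ 2, it remains to see
    that (1 + x) (1 - x + 2 x ^ 2) = 1 + x ^ 2 (1 + 2 x) >= 1. *)
Lemma expR_le_1Dx (x : R) : - 2^-1 <= x -> expR (x - 2 * x ^+ 2) <= 1 + x.
Proof.
move=> Hx; have x1 : 0 < 1 + x by lra.
rewrite -(ler_pM2r (expR_gt0 (2 * x ^+ 2 - x))) -expRD.
rewrite (_ : x - 2 * x ^+ 2 + (2 * x ^+ 2 - x) = 0) ?expR0; last by ring.
apply: le_trans (ler_wpM2l (ltW x1) (expR_ge1Dx _)).
have : 0 <= x ^+ 2 * (1 + 2 * x) by rewrite mulr_ge0 ?sqr_ge0 //; lra.
by rewrite !expr2; nra.
Qed.

Variable D : nat.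
Hypothesis reg : regular e D.

Definition total_deviation v X : R := \sum_(w | e v w) deviation v w X.

(** The product in [sum_prod_deviation] has Gibbs mean 1; [expR_le_1Dx] bounds each factor below by
    an exponential. *)
Lemma exp_moment v theta : - 2^-1 <= theta <= 2^-1 ->
  \sum_X gibbs e lambda X * expR (theta * total_deviation v X - 2 * theta ^+ 2 * D%:R) <= 1.
Proof.
move=> Ht; have Z0 := partition_function_gt0 e lambda_ge0.
have prod1 : \sum_X gibbs e lambda X *
    \prod_(w <- enum (e v)) (1 + theta * deviation v w X) = 1.
  under eq_bigr do rewrite gibbsE mulrAC.
  rewrite -mulr_suml sum_prod_deviation ?divff ?gt_eqF ?enum_uniq //.
  by apply/allP => w; rewrite mem_enum.
rewrite -[leRHS]prod1; apply: ler_sum => X _; rewrite ler_wpM2l ?gibbs_ge0 //.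
rewrite big_enum_cond /=.
have -> : theta * total_deviation v X - 2 * theta ^+ 2 * D%:R =
    \sum_(w | e v w) (theta * deviation v w X - 2 * theta ^+ 2).
  by rewrite sumrB -mulr_sumr -(reg v) [in LHS]mulr_natr -sumr_const.
rewrite expR_sum [leRHS](eq_bigl (e v)) => [|w]; last by rewrite andbT.
apply: ler_prod => w vw; rewrite expR_ge0 /=.
have := norm_deviation v w X; set d := deviation v w X; rewrite ler_norml => /andP[d1 d2].
apply: le_trans (expR_le_1Dx _); last by nra.
rewrite ler_expR lerD2l lerN2 exprMn mulrA ler_piMr //; first by rewrite mulr_ge0 ?sqr_ge0.
by rewrite -real_normK ?num_real // exprn_ile1 // ler_norml d1.
Qed.

Lemma deviation_tail v (eta : R) : 0 < eta <= 1 ->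
  \sum_X gibbs e lambda X * (eta * D%:R < `|total_deviation v X|)%R%:R <=
  2 * expR (- (eta ^+ 2 / 8 * D%:R)).
Proof.
move=> /andP[e0 e1].
(* The two signs serve the two tails. With |theta| = eta / 4 the cost 2 theta ^ 2 = eta ^ 2 / 8 is
   half of the gain |theta| eta. *)
have H theta : theta = eta / 4 \/ theta = - (eta / 4) -> \sum_X gibbs e lambda X *
    expR (theta * total_deviation v X - eta ^+ 2 / 4 * D%:R) <= expR (- (eta ^+ 2 / 8 * D%:R)).
  move=> Ht; have Hm : \sum_X gibbs e lambda X *
    expR (theta * total_deviation v X - 2 * theta ^+ 2 * D%:R) <= 1.
    by apply: exp_moment; case: Ht => ->; lra.
  have Et : theta ^+ 2 = eta ^+ 2 / 16 by case: Ht => ->; rewrite !expr2; field.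
  rewrite -[leRHS]mul1r; apply: le_trans (ler_wpM2r (expR_ge0 _) Hm).
  rewrite mulr_suml le_eqVlt; apply/orP; left; apply/eqP/eq_bigr => X _.
  by rewrite -[RHS]mulrA -expRD Et; congr (_ * expR _); field.
rewrite mulr_natl [leRHS]mulr2n.
apply: le_trans (lerD (H _ (or_introl erefl)) (H _ (or_intror erefl))).
rewrite -big_split /=; apply: ler_sum => X _; rewrite -mulrDr ler_wpM2l ?gibbs_ge0 //.
have [Hd|_] := ltP; last by rewrite addr_ge0 // expR_ge0.
have [Hp|Hn] := lerP 0 (total_deviation v X).
  rewrite /= -[leLHS]addr0 lerD ?expR_ge0 // -[leLHS]expR0 ler_expR.
  by rewrite (ger0_norm Hp) in Hd; rewrite expr2; nra.
rewrite /= -[leLHS]add0r lerD ?expR_ge0 // -[leLHS]expR0 ler_expR.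
by rewrite (ltr0_norm Hn) in Hd; rewrite expr2; nra.
Qed.

End LocalUniformity.

(** * The recursion x -> c exp(- x) *)

Section Inequalities.
Import numFieldTopology.Exports numFieldNormedType.Exports.
Local Open Scope classical_set_scope.
Local Open Scope ring_scope.
Variable R : realType.
Implicit Types x u : R.

(** The left-hand side equals 1 at x = 1, and its derivative 1 / c - exp(1 - c) is nonnegative
    because c <= exp(c - 1). *)
Lemma ln_add_expR_le1 x : 0 < x <= 1 -> ln x + expR (1 - x) <= 1.
Proof.
case/andP=> x0 x1.
have df (c : R) : 0 < c ->
    is_derive c 1 (@ln R + (expR \o (cst 1 - id))) (c^-1 + expR (1 - c) * (0 - 1)).
  move=> c0; have d1 : is_derive c 1 (cst 1 - id : R -> R) (0 - 1) by exact: is_deriveB.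
  exact: (is_deriveD (is_derive1_ln c0) (@is_derive1_comp _ expR (cst 1 - id) c _ _ (is_derive_expR (1 - c)) d1)).
have cf : {within `[x, 1], continuous (@ln R + (expR \o (cst 1 - id)) : R -> R)}.
  apply: derivable_within_continuous => c; rewrite in_itv /= => /andP[xc _].
  exact: (ex_derive (is_derive := df c (lt_le_trans x0 xc))).
have df' c : c \in `]x, 1[ -> is_derive c 1 (@ln R + (expR \o (cst 1 - id)))
    (c^-1 + expR (1 - c) * (0 - 1)).
  by rewrite in_itv /= => /andP[xc _]; exact: df (lt_trans x0 xc).
have [c] := MVT_segment x1 df' cf.
rewrite in_itv /= => /andP[xc c1] H.
have c0 := lt_le_trans x0 xc.
have f1 : (@ln R + (expR \o (cst 1 - id))) 1 = 1 :> R by rewrite /= !fctE subrr expR0 ln1 add0r.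
have fx : (@ln R + (expR \o (cst 1 - id))) x = ln x + expR (1 - x) by rewrite !fctE.
rewrite -fx -[leRHS]f1 -subr_ge0 H mulr_ge0 ?subr_ge0 //.
rewrite sub0r mulrN1 subr_ge0 -[leRHS]div1r ler_pdivlMr //.
have cE : c <= expR (c - 1) by apply: le_trans (expR_ge1Dx _); rewrite addrC subrK.
apply: le_trans (ler_wpM2l (expR_ge0 (1 - c)) cE) _.
by rewrite -expRD addrA subrK subrr expR0.
Qed.

Lemma expR_one_sub_le u : 0 <= u -> expR (1 - expR (- u)) <= 1 + u.
Proof.
move=> u0; have H : 0 < expR (- u) <= 1.
  by rewrite expR_gt0 -expR0 ler_expR oppr_le0.
by have := ln_add_expR_le1 H; rewrite expRK; lra.
Qed.

(** From 1 - x / 2 <= exp(- x / 2) follows exp(x) <= 1 / (1 - x / 2) ^ 2; the rest is polynomial. *)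
Lemma one_sub_mul_expR_le x : 0 <= x <= 1 -> (1 - x) * expR x <= 1 - x ^+ 2 / 4.
Proof.
case/andP=> x0 x1.
have E : expR x * expR (- x / 2) ^+ 2 = 1.
  by rewrite expr2 -!expRD -[RHS]expR0; congr expR; field.
have H : 1 - x / 2 <= expR (- x / 2) by apply: le_trans (expR_ge1Dx _); lra.
have H2 : (1 - x / 2) ^+ 2 <= expR (- x / 2) ^+ 2 by rewrite lerXn2r ?nnegrE ?expR_ge0 //; lra.
have H3 : expR x * (1 - x / 2) ^+ 2 <= 1 by rewrite -[leRHS]E ler_wpM2l ?expR_ge0.
have e0 := expR_gt0 x.
have d0 : 0 < (1 - x / 2) ^+ 2 by rewrite exprn_gt0 //; lra.
have H4 : expR x <= ((1 - x / 2) ^+ 2)^-1 by rewrite -div1r ler_pdivlMr.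
apply: (@le_trans _ _ ((1 - x) * ((1 - x / 2) ^+ 2)^-1)); first by rewrite ler_wpM2l // subr_ge0.
rewrite ler_pdivrMr // -subr_ge0.
rewrite (_ : _ - _ = x ^+ 2 / 4 * (x * (1 - x / 4))); last by field.
by rewrite mulr_ge0 ?divr_ge0 ?sqr_ge0 // mulr_ge0 //; lra.
Qed.

Lemma expR_le_1D2x x : 0 <= x <= 2^-1 -> expR x <= 1 + 2 * x.
Proof.
case/andP=> x0 x1; have E : expR x * expR (- x) = 1 by rewrite -expRD subrr expR0.
have := expR_ge1Dx (- x); have := expR_gt0 x => e0 H.
have : expR x * (1 - x) <= 1 by rewrite -[leRHS]E ler_wpM2l // ltW.
nra.
Qed.

(* If c <= e, the map x |-> c * exp(- c * exp(- x)), which has the same fixed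
   point as x |-> c * exp(- x), lies below the identity on [1, oo). *)
Lemma two_step_map_le (eps c u : R) : 0 < eps <= 1 -> 0 <= c <= (1 - eps) * expR 1 -> 1 <= u ->
  c * expR (- (c * expR (- u))) <= u * (1 - eps ^+ 2 / 4).
Proof.
move=> /andP[eps0 eps1] /andP[c0 c1] u1; set a := c / expR 1; set z := expR (1 - u).
have e0 := expR_gt0 (1 : R).
have ca : c = a * expR 1 by rewrite /a divfK // gt_eqF.
have a0 : 0 <= a by rewrite /a divr_ge0 // ltW.
have a1 : a <= 1 - eps by rewrite /a ler_pdivrMr.
have z1 : z <= 1 by rewrite /z -[leRHS]expR0 ler_expR; lra.
(* The factor a exp(1 - a) carries the gain; the other one is at most exp(1 - z) <= u. *)
have -> : c * expR (- (c * expR (- u))) = a * expR (1 - a) * expR (a * (1 - z)).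
  rewrite ca -mulrA -expRD -[in RHS]mulrA -expRD; congr (_ * expR _).
  by rewrite -(mulrA a) -expRD -/z; ring.
have Ha : a * expR (1 - a) <= 1 - eps ^+ 2 / 4.
  apply: (@le_trans _ _ (1 - (1 - a) ^+ 2 / 4)).
    by rewrite -[X in X * _](subKr 1 a) one_sub_mul_expR_le //; lra.
  by rewrite !expr2; nra.
have Hz : expR (a * (1 - z)) <= u.
  apply: (@le_trans _ _ (expR (1 - z))).
    by rewrite ler_expR ler_piMl //; lra.
  have /expR_one_sub_le : 0 <= u - 1 by lra.
  by rewrite opprB -/z; lra.
by rewrite mulrC ler_pM // ?expR_ge0 // mulr_ge0 ?expR_ge0.
Qed.

(** Inserting the lower bound on [L] into the upper bound on [U] applies the two-step map, whose
    gain eps ^ 2 / 4 outweighs the losses due to [eta']. *)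
Lemma two_sided_recursion (eps c eta' U L : R) : 0 < eps <= 1 ->
  0 <= c <= (1 - eps) * expR 1 -> 0 <= eta' <= eps ^+ 2 / 16 ->
  U <= c * expR (- L) + eta' -> c * expR (- U) - eta' <= L -> U <= 1 - eps ^+ 2 / 32.
Proof.
move=> Heps Hc /andP[eta0 eta1] HU HL.
have [/andP[eps0 eps1] /andP[c0 c1]] := (Heps, Hc).
rewrite leNgt; apply/negP => H.
(* The two-step estimate needs an argument of at least 1; under the negated conclusion the maximum
   exceeds [U] by at most eps ^ 2 / 32. *)
pose U' := Num.max U 1.
have U'1 : 1 <= U' by rewrite /U' le_max lexx orbT.
have UU' : U <= U' by rewrite /U' le_max lexx.
have U'U : U' - eps ^+ 2 / 32 <= U.
  have := sqr_ge0 eps; rewrite /U'; case: (leP U 1); lra.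
have HL' : c * expR (- U') - eta' <= L.
  apply: le_trans HL; rewrite lerD2r ler_wpM2l // ler_expR; lra.
have := two_step_map_le Heps Hc U'1; set Y := c * expR _ => HY.
have HU' : U <= Y * expR eta' + eta'.
  apply: le_trans HU _; rewrite lerD2r /Y -mulrA -expRD ler_wpM2l // ler_expR; lra.
have e1 : expR eta' <= 1 + 2 * eta' by apply: expR_le_1D2x; rewrite expr2 in eta1; nra.
have e2 : Y * expR eta' <= U' * (1 - eps ^+ 2 / 4) * (1 + 2 * eta').
  apply: ler_pM; rewrite ?expR_ge0 ?mulr_ge0 ?expR_ge0 //.
have x1 : eps ^+ 2 <= 1 by rewrite expr_le1 // ltW.
have x0 : 0 < eps ^+ 2 by rewrite exprn_gt0.
set x := eps ^+ 2 in x0 x1 eta1 HY HU' e1 e2 H U'U *.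
have e3 : (1 - x / 4) * (1 + 2 * eta') <= 1 - x / 8 by nra.
have e4 : U' * ((1 - x / 4) * (1 + 2 * eta')) <= U' * (1 - x / 8) by rewrite ler_wpM2l //; lra.
nra.
Qed.

End Inequalities.

Lemma expR1_le4 (R : realType) : expR 1 <= 4 :> R.
Proof.
have -> : (1 : R) = 2^-1 + 2^-1 by field.
have H : expR 2^-1 <= 2 :> R by apply: le_trans (expR_le_1D2x _) _; lra.
have e0 := expR_gt0 (2^-1 : R).
by rewrite expRD; nra.
Qed.

Lemma slack_le (R : realType) (x y : R) :
  y <= x / 256 -> 4 * (x / 128 + 2 * y) <= x / 16.
Proof. by move=> xy; lra. Qed.

(** * Few unblocked neighbours when all deviations are small *)

Section Good.
Variables (R : realType) (n D : nat) (e : rel 'I_n) (lambda eps : R).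
Hypotheses (reg : regular e D) (lambda_ge0 : 0 <= lambda) (eps01 : 0 < eps <= 1).
Hypothesis lambda_le : lambda <= (1 - eps) * expR 1 / D%:R.
Hypothesis D_ge : 1024 / eps ^+ 2 <= D%:R.
Implicit Types (X : {set 'I_n}) (v w : 'I_n).

(** Turns powers of 1 + lambda into exponentials, and lies between lambda / (1 + lambda) and
    lambda. *)
Let mu : R := ln (1 + lambda).
Let S X v : nat := #|[set w | e v w && free e X v w]|.

Let onelam : 0 < 1 + lambda. Proof. by rewrite ltr_pwDl. Qed.

Let mu_ge0 : 0 <= mu. Proof. by rewrite ln_ge0 // lerDl. Qed.

Let mu_le : mu <= lambda.
Proof. by apply: le_ln1Dx; apply: lt_le_trans lambda_ge0; rewrite ltrN10. Qed.

Let expR_mu k : expR (mu * k%:R) = (1 + lambda) ^+ k.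
Proof. by rewrite mulrC expRM_natl lnK. Qed.

Let p_le : lambda / (1 + lambda) <= mu.
Proof.
rewrite -ler_expR lnK // -[leLHS]invrK -expRN -[leRHS]invrK.
rewrite lef_pV2 ?posrE ?invr_gt0 ?expR_gt0 //; apply: le_trans (expR_ge1Dx _).
by rewrite le_eqVlt; apply/orP; left; apply/eqP; field; rewrite gt_eqF.
Qed.

(** [S X w] may also count [v], so it exceeds the number of free children by at most 1, at the cost
    of a factor 1 + lambda. The summand [lambda] absorbs the influence of the state of [v]. *)
Lemma free_prob_bounds X v w : e v w ->
  expR (- (mu * (S X w)%:R)) <= free_prob e lambda X v w <=
  (1 + lambda) * expR (- (mu * (S X w)%:R)) + lambda.
Proof.
move=> vw; set a := #|free_children e X v w|.
have [a1 a2] : (a <= S X w)%N /\ (S X w <= a.+1)%N.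
  rewrite /S (cardsD1 v) (_ : _ :\ v = free_children e X v w).
    by rewrite leq_addl -[a.+1]add1n leq_add2r leq_b1.
  by apply/setP => x; rewrite !inE andbCA.
set b := (1 + lambda) ^+ a.
have b1 : 1 <= b by rewrite exprn_ege1 // lerDl.
have lo : expR (- (mu * (S X w)%:R)) <= b^-1.
  rewrite expRN expR_mu lef_pV2 ?posrE ?exprn_gt0 //.
  by rewrite ler_weXn2l // lerDl.
have hi : b^-1 <= (1 + lambda) * expR (- (mu * (S X w)%:R)).
  rewrite expRN expR_mu ler_pdivlMr ?exprn_gt0 // mulrC ler_pdivrMr ?exprn_gt0 //.
  by rewrite -exprS ler_weXn2l // lerDl.
rewrite /free_prob -/a -/b; set s := if _ then _ else _.
have [s0 s1] : 0 <= s /\ s <= lambda by rewrite /s; case: ifP.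
have bs : 0 < b + s by lra.
have E : (1 + s) / (b + s) - b^-1 = s * (b - 1) / (b * (b + s)).
  by field; rewrite !gt_eqF //; lra.
have E1 : 0 <= (1 + s) / (b + s) - b^-1.
  by rewrite E divr_ge0 ?mulr_ge0 //; lra.
have E2 : (1 + s) / (b + s) - b^-1 <= s.
  rewrite E ler_pdivrMr ?mulr_gt0 //; last by lra.
  by rewrite ler_wpM2l //; nra.
lra.
Qed.

Lemma not_bad X : (forall v, `|total_deviation e lambda v X| <= eps ^+ 2 / 128 * D%:R) ->
  ~~ bad e (lambda / (1 + lambda)) (eps ^+ 2 / 32) X.
Proof.
move=> Hdev; apply/existsPn => v0; rewrite -leNgt.
set eta := eps ^+ 2 / 128.
case/andP: (eps01) => eps0 eps1.
have eps2 : 0 < eps ^+ 2 by rewrite exprn_gt0.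
have D0 : 0 < D%:R :> R by apply: lt_le_trans D_ge; rewrite divr_gt0 ?ltr0n.
set c := mu * D%:R.
have c0 : 0 <= c by rewrite mulr_ge0 // ltW.
have c1 : c <= (1 - eps) * expR 1.
  by rewrite /c -ler_pdivlMr //; exact: le_trans lambda_le.
have c4 : c <= 4 by apply: le_trans c1 _; have := expR1_le4 R; have := expR_gt0 (1 : R); nra.
(* By e <= 4 and [D_ge], as lambda <= e / D. *)
have lam : lambda <= eps ^+ 2 / 256.
  apply: le_trans lambda_le _; rewrite ler_pdivrMr //.
  have : 4 <= eps ^+ 2 / 256 * D%:R.
    by move: D_ge; rewrite ler_pdivrMr // => H; lra.
  by have := expR1_le4 R; have := expR_gt0 (1 : R); nra.
have SE v : (S X v)%:R = total_deviation e lambda v X + \sum_(w | e v w) free_prob e lambda X v w.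
  rewrite /total_deviation /deviation sumrB subrK /S -sum1dep_card natr_sum big_mkcondr /=.
  by apply: eq_bigr => w _; case: ifP.
have sumD (x : R) v : \sum_(w | e v w) x = D%:R * x.
  by rewrite -(reg v) mulr_natl -sumr_const.
(* At the extremal vertices, [S] at the neighbours lies between the same two extremes, which closes
   the recursion. *)
pose vM := [arg max_(v > v0) S X v]%N; pose vm := [arg min_(v < v0) S X v]%N.
have HM v : (S X v <= S X vM)%N by rewrite /vM; case: arg_maxnP => // i _; apply.
have Hm v : (S X vm <= S X v)%N by rewrite /vm; case: arg_minnP => // i _; apply.
set U := mu * (S X vM)%:R; set L := mu * (S X vm)%:R.
have UE : U <= c * expR (- L) + c * (eta + 2 * lambda).
  have eL : expR (- L) <= 1 by rewrite -[leRHS]expR0 ler_expR oppr_le0 mulr_ge0.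
  have : (S X vM)%:R <= eta * D%:R + D%:R * ((1 + lambda) * expR (- L) + lambda).
    rewrite SE lerD //; first by have := Hdev vM; rewrite ler_norml => /andP[].
    rewrite -(sumD _ vM); apply: ler_sum => w vw.
    have /andP[_ H] := free_prob_bounds X vw; apply: le_trans H _; rewrite lerD2r.
    by rewrite ler_wpM2l ?ler_expR ?lerN2 ?ler_wpM2l ?ler_nat // ltW.
  move=> /(ler_wpM2l mu_ge0); rewrite -/U => H; apply: le_trans H _.
  rewrite (_ : mu * _ = c * (eta + ((1 + lambda) * expR (- L) + lambda))); last by rewrite /c; ring.
  by rewrite -mulrDr ler_wpM2l //; have := ler_wpM2l lambda_ge0 eL; lra.
have LE : c * expR (- U) - c * (eta + 2 * lambda) <= L.
  have : D%:R * expR (- U) - eta * D%:R <= (S X vm)%:R.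
    rewrite SE addrC lerD //; first by have := Hdev vm; rewrite ler_norml => /andP[].
    rewrite -(sumD _ vm); apply: ler_sum => w vw.
    have /andP[H _] := free_prob_bounds X vw; apply: le_trans _ H.
    by rewrite ler_expR lerN2 ler_wpM2l // ler_nat.
  move=> /(ler_wpM2l mu_ge0); rewrite -/L; apply: le_trans.
  rewrite (_ : mu * _ = c * expR (- U) - c * eta); last by rewrite /c; ring.
  by rewrite lerD2l lerN2 ler_wpM2l // lerDl mulr_ge0.
have Heta : 0 <= c * (eta + 2 * lambda) <= eps ^+ 2 / 16.
  have eta0 : 0 <= eta by rewrite divr_ge0 ?ler0n // ltW.
  have E0 : 0 <= eta + 2 * lambda by rewrite addr_ge0 // mulr_ge0 // ler0n.
  rewrite mulr_ge0 //=; apply: le_trans (ler_wpM2r E0 c4) _.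
  exact: slack_le.
have HU : U <= 1 - eps ^+ 2 / 32.
  by apply: (two_sided_recursion eps01 _ Heta UE LE); rewrite c0 c1.
(* An unblocked neighbour of [v0] is counted by [S], and lambda / (1 + lambda) <= mu. *)
apply: le_trans HU; rewrite /U.
apply: ler_pM => //; first by rewrite divr_ge0 // ltW.
rewrite ler_nat; apply: leq_trans (HM v0); apply/subset_leq_card/fintype.subsetP => w.
rewrite !inE => /andP[-> nb] /=; apply/forallP => x; apply/implyP => /andP[wx xX].
by case/existsP: nb; exists x; rewrite wx.
Qed.

End Good.

Section BadProbability.
Variables (R : realType) (n D : nat) (e : rel 'I_n) (lambda eps : R).
Hypotheses (e_simple : simple_graph e) (reg : regular e D) (girth6 : (6%:E <= girth R e)%E).
Hypotheses (lambda_ge0 : 0 <= lambda) (eps01 : 0 < eps <= 1).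
Hypothesis lambda_le : lambda <= (1 - eps) * expR 1 / D%:R.
Hypothesis D_ge : 1024 / eps ^+ 2 <= D%:R.

(** Union bound: by [not_bad], a bad set has a large total deviation at some vertex. *)
Lemma bad_prob : \sum_X gibbs e lambda X * (bad e (lambda / (1 + lambda)) (eps ^+ 2 / 32) X)%:R <=
  n%:R * (2 * expR (- ((eps ^+ 2 / 128) ^+ 2 / 8 * D%:R))).
Proof.
have [e_sym e_irr] := e_simple.
have no3 := no_cycle3 e_irr girth6.
have no4 := no_cycle4 e_irr girth6.
have no5 := no_cycle5 e_irr girth6.
set eta := eps ^+ 2 / 128.
have eta01 : 0 < eta <= 1.
  case/andP: eps01 => e0 e1; rewrite /eta divr_gt0 ?exprn_gt0 //= ler_pdivrMr // mul1r.
  by apply: le_trans (_ : 1 <= _); [rewrite expr_le1 // ltW | rewrite ler1n].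
rewrite -[X in X%:R * _]card_ord mulr_natl -sumr_const.
apply: le_trans (ler_sum _ (fun v _ => deviation_tail e_sym e_irr no3 no4 no5 lambda_ge0 reg v eta01)).
rewrite exchange_big /=; apply: ler_sum => X _; rewrite -mulr_sumr ler_wpM2l ?gibbs_ge0 //.
have [|_] := boolP (bad _ _ _ _); last by apply: sumr_ge0.
apply: contraLR; rewrite -ltNge => H; apply: (not_bad reg lambda_ge0 eps01 lambda_le D_ge).
move=> v; rewrite leNgt; apply: contraTN H => Hv; rewrite -leNgt (bigD1 v) //= Hv lerDl.
exact: sumr_ge0.
Qed.

End BadProbability.

(** * Annealing *)

(** The numbers b with b + 1 <= tau are those below the integer part of [tau], so rounding costs at
    most 2 ^ - l. *)
Lemma accept_prob_bounds (R : realType) l (tau : R) : 0 <= tau <= 2 ^+ l ->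
  (tau - 1) / 2 ^+ l <= accept_prob l tau <= tau / 2 ^+ l.
Proof.
case/andP=> t0 tl; have N0 : 0 < 2 ^+ l :> R by rewrite exprn_gt0.
have tN : (Num.truncn tau <= 2 ^ l)%N.
  rewrite -(ler_nat R) natrX; apply: le_trans tl.
  by case/andP: (truncn_itv t0).
have -> : accept_prob l tau = (Num.truncn tau)%:R / 2 ^+ l.
  have := big_ord_widen _ (fun=> 1%N) tN : (\sum_(i < _) 1 = \sum_(i < _ | _) 1)%N.
  rewrite big_const_ord iter_addn mul1n addn0 => ->.
  congr (_%:R / _); rewrite -sum1_card; apply: eq_bigl => b.
  by rewrite inE truncn_gt_nat.
case/andP: (truncn_itv t0) => H1 H2; rewrite -natr1 in H2.
by rewrite !ler_pM2r ?invr_gt0 // H1 andbT lerBlDr ltW.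
Qed.

Lemma accept_prob_le (R : realType) l (tau tau' : R) : tau <= tau' ->
  accept_prob l tau <= accept_prob l tau'.
Proof.
move=> tt; rewrite ler_wpM2r ?invr_ge0 ?exprn_ge0 // ler_nat subset_leq_card //.
by apply/fintype.subsetP => b; rewrite !inE => /le_trans; apply.
Qed.

Lemma accept_prob_ge0 (R : realType) l (tau : R) : 0 <= accept_prob l tau.
Proof. by rewrite divr_ge0 // exprn_ge0. Qed.

(** The indicator of nu < mu attains the variation distance, so one-sided bounds suffice. *)
Lemma tv_dist_le (R : realType) (T : finType) (mu nu : T -> R) (d : R) :
  \sum_x mu x = 1 -> \sum_x nu x = 1 ->
  (forall g : T -> R, (forall x, 0 <= g x <= 1) -> \sum_x mu x * g x - \sum_x nu x * g x <= d) ->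
  tv_dist mu nu <= d.
Proof.
move=> mu1 nu1 Hg; pose g x : R := (nu x < mu x)%R%:R.
apply: le_trans (Hg g _); last by move=> x; rewrite /g ler0n lern1 leq_b1.
have -> : \sum_x mu x * g x - \sum_x nu x * g x = 2^-1 *
   (\sum_x (2 * (mu x - nu x) * g x - (mu x - nu x))).
  have D0 : \sum_x (mu x - nu x) = 0 by rewrite sumrB mu1 nu1 subrr.
  rewrite [X in 2^-1 * X]sumrB D0 subr0 -sumrB mulr_sumr.
  by apply: eq_bigr => x _; field.
rewrite /tv_dist ler_pM2l ?invr_gt0 //; apply: ler_sum => x _; rewrite /g.
by case: ltrP => H /=; lra.
Qed.

Lemma accept_prob_le1 (R : realType) l (tau : R) : accept_prob l tau <= 1.
Proof.
rewrite ler_pdivrMr ?exprn_gt0 // mul1r -natrX ler_nat.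
by rewrite -[leqRHS]card_ord max_card.
Qed.

Section Anneal.
Variables (R : realType) (n l kappa N : nat) (e : rel 'I_n) (theta : R).
Hypotheses (e_simple : simple_graph e) (nk : (n < 2 ^ kappa)%N).
Implicit Types (g : {set 'I_n} -> R).

Lemma annealS r s g : anneal e l kappa N theta r.+1 s g =
  iter N (update_op (2 ^ kappa) (update e) (accept_prob l (s.+1%:R * theta)))
    (anneal e l kappa N theta r s.+1 g).
Proof. by apply: eq_iter => h; apply: funext => X; rewrite step_opE // ltnW. Qed.

Lemma anneal01 r s g : (forall X, 0 <= g X <= 1) ->
  forall X, 0 <= anneal e l kappa N theta r s g X <= 1.
Proof.
move=> g01; elim: r s => [|r IH] s //; rewrite annealS.
apply: iter_update_op01 => //; first by rewrite accept_prob_ge0 accept_prob_le1.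
- exact: ltnW.
- by rewrite expn_gt0.
Qed.

Lemma anneal_independent r s g : (forall X, independent e X -> g X = 0) ->
  forall X, independent e X -> anneal e l kappa N theta r s g X = 0.
Proof.
have [e_sym e_irr] := e_simple.
move=> g0; elim: r s => [|r IH] s; [exact: g0 | rewrite annealS].
apply: (iter_update_op_eq0 _ _ (P := independent e)); last exact: IH.
by move=> Y w b; exact: independent_update.
Qed.

Variables (rho K beta : R) (lam : nat -> R).
Hypotheses (rho01 : 0 <= rho <= 1) (lam_ge0 : forall s, 0 <= lam s).
Hypothesis lam_prob : forall s, (s <= n)%N ->
  accept_prob l (s%:R * theta) = lam s / (1 + lam s).
Hypothesis K_ge0 : 0 <= K.
Hypothesis lam_step : forall s X, (s < n)%N -> gibbs e (lam s) X <= K * gibbs e (lam s.+1) X.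
Hypothesis bad_le : forall s, (s < n)%N ->
  \sum_X gibbs e (lam s.+1) X * (bad e (lam s.+1 / (1 + lam s.+1)) rho X)%:R <= beta.

(** Telescoping: [mixing] compares stage s + 1, started from gibbs (lam s), with its stationary law
    gibbs (lam s.+1); the later stages are absorbed into the test function. *)
Lemma anneal_error r s g : (s + r = n)%N -> (forall X, 0 <= g X <= 1) ->
  \sum_X gibbs e (lam s) X * anneal e l kappa N theta r s g X -
    \sum_X gibbs e (lam n) X * g X <=
  r%:R * ((1 - rho / (2 ^ kappa)%:R) ^+ N * n%:R + N%:R * ((K + 1) * beta)).
Proof.
have [e_sym e_irr] := e_simple.
move=> + g01; elim: r s => [|r IH] s Hs.
  by rewrite (_ : s = n) ?subrr ?mul0r -?Hs ?addn0.
have sn : (s < n)%N by lia.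
rewrite annealS lam_prob //; set h := anneal _ _ _ _ _ _ _ _.
have M0 : (0 < 2 ^ kappa)%N by rewrite expn_gt0.
have prob01 : 0 <= lam s.+1 / (1 + lam s.+1) <= 1.
  by rewrite -lam_prob // accept_prob_ge0 accept_prob_le1.
have H : \sum_X gibbs e (lam s.+1) X * h X - \sum_X gibbs e (lam n) X * g X <=
  r%:R * ((1 - rho / (2 ^ kappa)%:R) ^+ N * n%:R + N%:R * ((K + 1) * beta)) by apply: IH; lia.
have := mixing e_sym prob01 rho01 (ltnW nk) M0 (fun X => gibbs_ge0 e X (lam_ge0 s))
  (sum_gibbs e (lam_ge0 s)) (fun X => gibbs_ge0 e X (lam_ge0 s.+1))
  (sum_gibbs e (lam_ge0 s.+1)) (fun X => lam_step X sn)
  (fun g => gibbs_stationary e_sym e_irr g (lam_ge0 s.+1) M0) N (anneal01 r s.+1 g01).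
rewrite -/h; set A := \sum_X _; set B := \sum_X _ in H *; set b := \sum_X _ * _%:R => Hm.
have Hb : N%:R * ((K + 1) * b) <= N%:R * ((K + 1) * beta).
  by rewrite ler_wpM2l // ler_wpM2l ?addr_ge0 //; exact: bad_le.
have : A - B <= (1 - rho / (2 ^ kappa)%:R) ^+ N * n%:R + N%:R * ((K + 1) * beta).
  by apply: le_trans (ler_norm _) (le_trans Hm _); rewrite lerD2l.
by rewrite [r.+1%:R]mulrSr mulrDl mul1r; lra.
Qed.

End Anneal.

(** * Numerical estimates *)

Section Numerics.
Variable R : realType.
Implicit Types (x h : R).

Lemma expr_one_sub_le x N : x <= 1 -> (1 - x) ^+ N <= expR (- (x * N%:R)).
Proof.
move=> x1; rewrite -mulNr expRM_natr lerXn2r ?nnegrE ?subr_ge0 ?expR_ge0 //.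
exact: expR_ge1Dx.
Qed.

Lemma expr_1D_le h N : 0 <= h -> (1 + h) ^+ N <= expR (h * N%:R).
Proof.
move=> h0; rewrite expRM_natr lerXn2r ?nnegrE ?addr_ge0 ?expR_ge0 //.
exact: expR_ge1Dx.
Qed.

Lemma expR_opp_nat_le l : expR (- l%:R) <= (2 ^+ l)^-1 :> R.
Proof.
rewrite expRN lef_pV2 ?posrE ?expR_gt0 ?exprn_gt0 // -[l%:R]mul1r expRM_natr.
by rewrite lerXn2r ?nnegrE ?expR_ge0 // -[leLHS](natrD _ 1 1) natrD expR_ge1Dx.
Qed.

(** As M <= 2 n and rho n >= 4, the exponent rho n ^ 2 l / M is at least 2 l, and exp(- 2 l) <= 4 ^
    - l <= q ^ 2. *)
Lemma mixing_term_le (rho q : R) (n M l : nat) : 0 < rho <= 1 -> (0 < n)%N ->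
  (n <= M <= 2 * n)%N -> 4 <= rho * n%:R -> (2 ^+ l)^-1 <= q ->
  (1 - rho / M%:R) ^+ (n * n * l) <= q ^+ 2.
Proof.
move=> /andP[rho0 rho1] n0 /andP[nM M2n] rn ql.
have M0 : (0 < M)%N := leq_trans n0 nM.
have M0R : 0 < M%:R :> R by rewrite ltr0n.
have x1 : rho / M%:R <= 1.
  by rewrite ler_pdivrMr // mul1r; apply: le_trans rho1 _; rewrite ler1n.
apply: le_trans (expr_one_sub_le _ x1) _.
have q0 : 0 <= (2 ^+ l)^-1 :> R by rewrite invr_ge0 exprn_ge0.
apply: (@le_trans _ _ (expR (- l%:R) ^+ 2)); last first.
  by rewrite lerXn2r ?nnegrE ?expR_ge0 //; [exact: le_trans ql | exact: le_trans (expR_opp_nat_le l) ql].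
rewrite -expRM_natr ler_expR mulNr lerN2 !natrM.
rewrite (_ : rho / M%:R * (n%:R * n%:R * l%:R) = l%:R * (rho * n%:R * n%:R / M%:R)); last first.
  by field; rewrite gt_eqF.
rewrite ler_wpM2l // ler_pdivlMr //.
have : M%:R <= 2 * n%:R :> R by rewrite -natrM ler_nat.
have : 0 <= (rho * n%:R - 4) * n%:R by rewrite mulr_ge0 // subr_ge0.
lra.
Qed.

Lemma odds_sub_le (a b : R) : 0 <= a -> a <= b -> b <= 2^-1 ->
  0 <= b / (1 - b) - a / (1 - a) <= 4 * (b - a).
Proof.
move=> a0 ab b1.
have E : b / (1 - b) - a / (1 - a) = (b - a) / ((1 - b) * (1 - a)).
  by field; rewrite !gt_eqF //; lra.
have P : 4^-1 <= (1 - b) * (1 - a) by nra.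
rewrite E divr_ge0 ?ler_pdivrMr //=; [|nra..].
nra.
Qed.

Lemma half_ln2 : 2^-1 <= ln 2 :> R.
Proof.
rewrite -ler_expR lnK ?posrE //.
by apply: le_trans (expR_le_1D2x _) _; lra.
Qed.

(** The bounds on [l] and [K] reduce the left-hand side to n ^ 7 / (4 delta) times [t]; the ninth
    power in the bound on [t] compensates this. *)
Lemma stage_error_le (n l : nat) (K delta t : R) : (0 < n)%N -> 0 < delta <= 1 -> 0 <= K ->
  16 * (K + 1) <= n%:R -> l%:R <= 2 * (n%:R * n%:R / delta) ->
  0 <= t <= (delta / n%:R) ^+ 9 ->
  n%:R * ((n * n * l)%:R * ((K + 1) * (n%:R * (2 * t)))) <= delta / 4.
Proof.
move=> n0 /andP[d0 d1] K0 Kn lb /andP[t0 tb]; set x := n%:R in Kn lb tb *.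
have x1 : 1 <= x by rewrite /x ler1n.
have x0 : 0 < x by rewrite (lt_le_trans ltr01).
have -> : x * ((n * n * l)%:R * ((K + 1) * (x * (2 * t)))) =
    l%:R * t * (2 * (K + 1) * x ^+ 4).
  by rewrite !natrM -/x; ring.
apply: (@le_trans _ _ (2 * (x * x / delta) * (delta / x) ^+ 9 * (2 * (K + 1) * x ^+ 4))).
  rewrite ler_wpM2r ?ler_pM //.
  by rewrite !mulr_ge0 // ?addr_ge0 // exprn_ge0 // ltW.
have -> : 2 * (x * x / delta) * (delta / x) ^+ 9 * (2 * (K + 1) * x ^+ 4) =
    delta ^+ 8 / x ^+ 2 * (4 * (K + 1) / x).
  by field; rewrite !gt_eqF.
have H1 : 4 * (K + 1) / x <= 4^-1 by rewrite ler_pdivrMr //; lra.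
have H2 : delta ^+ 8 / x ^+ 2 <= delta.
  rewrite ler_pdivrMr ?exprn_gt0 // exprS ler_wpM2l ?(ltW d0) //.
  apply: (@le_trans _ _ 1); first by rewrite exprn_ile1 // ltW.
  by rewrite exprn_ege1.
apply: ler_pM => //; first by rewrite divr_ge0 // exprn_ge0 // ltW.
by rewrite divr_ge0 ?(ltW x0) // mulr_ge0 // addr_ge0.
Qed.

Lemma increment_le (a a' b c u v w : R) :
  b - u <= a -> a' <= b + c -> u <= v -> v <= w -> c <= w -> a' - a <= 2 * w.
Proof. by move=> *; lra. Qed.

End Numerics.

(** * Distance of the annealed chain from the Gibbs distribution *)

Section Main.
Variables (R : realType) (n D l kappa : nat) (e : rel 'I_n) (lambda eps delta : R).
Hypotheses (e_simple : simple_graph e) (reg : regular e D) (girth6 : (6%:E <= girth R e)%E).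
Hypotheses (lambda_gt0 : 0 < lambda) (eps01 : 0 < eps <= 1) (delta01 : 0 < delta <= 1).
Hypothesis lambda_le : lambda <= (1 - eps) * expR 1 / D%:R.
Hypothesis D_ge : 1024 / eps ^+ 2 <= D%:R.
Hypothesis n_ge : 1024 / eps ^+ 2 + 16 * (expR 8 + 1) <= n%:R.
Hypothesis tail_le : expR (- ((eps ^+ 2 / 128) ^+ 2 / 8 * D%:R)) <= (delta / n%:R) ^+ 9.
Hypothesis kappaP : forall s, (2 ^ s <= n)%N = (s < kappa)%N.
Hypothesis lP : forall s, (2 ^+ s <= n%:R * n%:R / delta) = (s < l)%N.

Let theta := threshold_step n lambda l.
Let p : R := lambda / (1 + lambda).
(** The acceptance probability actually realised at stage [s], after rounding; [lam s] is the
    fugacity with exactly these odds. *)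
Let a (s : nat) : R := accept_prob l (s%:R * theta).
Let lam (s : nat) : R := a s / (1 - a s).
Let q : R := delta / (n%:R * n%:R).

Let n16 : 16 <= n%:R :> R.
Proof.
apply: le_trans n_ge; have [e0 _] := andP eps01.
have := expR_gt0 (8 : R); have : 0 <= 1024 / eps ^+ 2 by rewrite divr_ge0 ?ler0n // exprn_ge0 // ltW.
by set x := 1024 / _; lra.
Qed.

Let n0 : 0 < n%:R :> R. Proof. exact: lt_le_trans n16. Qed.

Let two_l_gt0 : 0 < 2 ^+ l :> R. Proof. exact: exprn_gt0. Qed.

Let ql : (2 ^+ l)^-1 <= q.
Proof.
have [d0 _] := andP delta01.
rewrite -[q]invrK lef_pV2 ?posrE // ?invr_gt0 ?divr_gt0 ?mulr_gt0 //.
by rewrite invf_div ltW // ltNge lP ltnn.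
Qed.

Let l_le : l%:R <= 2 * (n%:R * n%:R / delta) :> R.
Proof.
have [d0 d1] := andP delta01.
have l0 : (0 < l)%N.
  rewrite -lP expr0 ler_pdivlMr // mul1r; apply: le_trans d1 _.
  by have := n16; set x := n%:R; nra.
apply: (@le_trans _ _ (2 ^+ l)); first by rewrite -natrX ler_nat ltnW // ltn_expl.
by rewrite -(prednK l0) exprS ler_wpM2l ?ler0n // lP ltn_predL.
Qed.

Let p01 : 0 <= p <= 2^-1.
Proof.
have l1 : lambda <= 1.
  apply: le_trans lambda_le _; have [e0 e1] := andP eps01.
  have D1 : 4 <= D%:R :> R.
    apply: le_trans D_ge; rewrite ler_pdivlMr ?exprn_gt0 //.
    have : eps ^+ 2 <= 1 by rewrite expr_le1 // ltW.
    by lra.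
  rewrite ler_pdivrMr; last by lra.
  by have := expR1_le4 R; have := expR_gt0 (1 : R); nra.
rewrite /p divr_ge0 ?(ltW lambda_gt0) ?addr_ge0 ?(ltW lambda_gt0) //=.
rewrite ler_pdivrMr; have := lambda_gt0; lra.
Qed.

Let thetaE : theta = p * 2 ^+ l / n%:R. Proof. by []. Qed.

Let theta_ge0 : 0 <= theta.
Proof. by have [p0 _] := andP p01; rewrite thetaE divr_ge0 // mulr_ge0 // ltW. Qed.

Let a_bounds s : (s <= n)%N -> s%:R * p / n%:R - (2 ^+ l)^-1 <= a s <= s%:R * p / n%:R.
Proof.
move=> sn; have [p0 p1] := andP p01.
have E0 : s%:R * theta / 2 ^+ l = s%:R * p / n%:R.
  by rewrite thetaE; field; rewrite !gt_eqF.
have E1 : (s%:R * theta - 1) / 2 ^+ l = s%:R * p / n%:R - (2 ^+ l)^-1.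
  by rewrite mulrBl E0 div1r.
rewrite -E1 -E0; apply: accept_prob_bounds; rewrite mulr_ge0 //=.
rewrite -[leRHS]mul1r -ler_pdivrMr // E0 ler_pdivrMr // mul1r.
apply: (@le_trans _ _ (n%:R * p)); first by rewrite ler_wpM2r // ler_nat.
by rewrite ler_piMr //; lra.
Qed.

Let a_ge0 s : 0 <= a s. Proof. exact: accept_prob_ge0. Qed.

Let a_le s : (s <= n)%N -> a s <= p.
Proof.
move=> sn; have [_ H] := andP (a_bounds sn); apply: le_trans H _.
have [p0 p1] := andP p01; rewrite ler_pdivrMr // mulrC ler_wpM2l //.
by rewrite ler_nat.
Qed.

Let a_mono s : a s <= a s.+1.
Proof. by rewrite /a accept_prob_le // ler_wpM2r // ler_nat. Qed.

Let lam_ge0 s : 0 <= lam s.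
Proof. by rewrite divr_ge0 // subr_ge0 accept_prob_le1. Qed.

Let lam_prob s : (s <= n)%N -> a s = lam s / (1 + lam s).
Proof.
move=> sn; have [_ p1] := andP p01; have Ha := a_le sn.
have H : 1 - a s != 0 by rewrite gt_eqF //; lra.
rewrite /lam; field; rewrite H /= gt_eqF //; lra.
Qed.

Let lambdaE : lambda = p / (1 - p).
Proof.
have l0 := lambda_gt0; have l1 : 1 + lambda != 0 by rewrite gt_eqF //; lra.
by rewrite /p; field; rewrite l1 /= gt_eqF //; lra.
Qed.

Let lam_le s : (s <= n)%N -> lam s <= lambda.
Proof.
move=> sn; have [_ p1] := andP p01.
by have [H _] := andP (odds_sub_le (a_ge0 s) (a_le sn) p1); rewrite lambdaE -subr_ge0.
Qed.

Let q_small : q <= n%:R^-1.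
Proof.
have [d0 d1] := andP delta01.
rewrite /q ler_pdivrMr ?mulr_gt0 // mulKf ?gt_eqF //.
by apply: le_trans d1 _; have := n16; lra.
Qed.

(** The acceptance probability grows by at most 1 / n plus a rounding error of at most 1 / n, hence
    the fugacity by at most 8 / n, and (1 + 8 / n) ^ n <= exp(8). *)
Let lam_step s X : (s < n)%N -> gibbs e (lam s) X <= expR 8 * gibbs e (lam s.+1) X.
Proof.
move=> sn; have [p0 p1] := andP p01.
have [H0 H1] := andP (odds_sub_le (a_ge0 s) (a_mono s) (le_trans (a_le sn) p1)).
have Hlam : 0 <= lam s <= lam s.+1 by rewrite lam_ge0 -subr_ge0.
apply: le_trans (gibbs_le e X Hlam) _; rewrite ler_wpM2r ?gibbs_ge0 //.
apply: le_trans (expr_1D_le _ H0) _; rewrite ler_expR.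
have [b1 _] := andP (a_bounds (ltnW sn)); have [_ b2] := andP (a_bounds sn).
have aa : a s.+1 - a s <= 2 * n%:R^-1.
  have pn : p / n%:R <= n%:R^-1 by rewrite ler_piMl ?invr_ge0 //; lra.
  have E : s.+1%:R * p / n%:R = s%:R * p / n%:R + p / n%:R by rewrite mulrSr; ring.
  rewrite E in b2; exact: increment_le b1 b2 ql q_small pn.
rewrite -ler_pdivlMr //; apply: le_trans H1 _; rewrite [8 / _]mulrC.
by move: aa; lra.
Qed.

Let bad_le s : (s < n)%N ->
  \sum_X gibbs e (lam s.+1) X * (bad e (lam s.+1 / (1 + lam s.+1)) (eps ^+ 2 / 32) X)%:R <=
  n%:R * (2 * expR (- ((eps ^+ 2 / 128) ^+ 2 / 8 * D%:R))).
Proof.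
move=> sn; apply: bad_prob => //.
by apply: le_trans lambda_le; exact: lam_le.
Qed.

Let lam0 : lam 0 = 0.
Proof.
have a0 : a 0 = 0.
  apply/eqP; rewrite eq_le a_ge0 andbT.
  by have [_] := andP (a_bounds (leq0n n)); rewrite !mul0r.
by rewrite /lam a0 mul0r.
Qed.

(** Rounding leaves the last fugacity at most 4 q short of lambda, and (1 + 4 q) ^ n <= 1 + delta /
    2 because 4 q n = 4 delta / n <= delta / 4. *)
Let final_gibbs g : (forall X, 0 <= g X <= 1) ->
  \sum_X gibbs e (lam n) X * g X <= \sum_X gibbs e lambda X * g X + delta / 2.
Proof.
move=> g01; have [d0 d1] := andP delta01; have [p0 p1] := andP p01.
have l0 := ltW lambda_gt0.
have [H0 H1] := andP (odds_sub_le (a_ge0 n) (a_le (leqnn n)) p1).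
rewrite -lambdaE -/(lam n) in H0 H1.
have H2 : p - a n <= q.
  have [b1 _] := andP (a_bounds (leqnn n)).
  move: b1 ql; rewrite mulrAC divff ?gt_eqF // mul1r; lra.
set h := lambda - lam n in H0 H1.
have hn : h * n%:R <= 4 * delta / n%:R.
  apply: (@le_trans _ _ (4 * q * n%:R)); first by rewrite ler_wpM2r //; lra.
  by rewrite /q le_eqVlt; apply/orP; left; apply/eqP; field; rewrite gt_eqF.
have dn : 4 * delta / n%:R <= delta / 4.
  rewrite ler_pdivrMr //; have := n16; nra.
have K1 : (1 + h) ^+ n <= 1 + delta / 2.
  apply: le_trans (expr_1D_le n H0) _; apply: le_trans (expR_le_1D2x _) _; last by lra.
  by rewrite mulr_ge0 //=; lra.
have Hlam : 0 <= lam n <= lambda by rewrite lam_ge0 -subr_ge0.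
apply: (@le_trans _ _ (\sum_X (gibbs e lambda X * g X + delta / 2 * gibbs e lambda X))); last first.
  by rewrite big_split /= -mulr_sumr sum_gibbs // mulr1.
apply: ler_sum => X _; have [g0 g1] := andP (g01 X).
have G := gibbs_ge0 e X l0.
have G2 : gibbs e (lam n) X <= (1 + delta / 2) * gibbs e lambda X.
  by apply: le_trans (gibbs_le e X Hlam) _; rewrite ler_wpM2r.
apply: le_trans (ler_wpM2r g0 G2) _.
rewrite mulrDl mul1r mulrDl lerD2l ler_piMr //.
by rewrite mulr_ge0 // divr_ge0 // ltW.
Qed.

Lemma anneal_close g : (forall X, 0 <= g X <= 1) ->
  anneal e l kappa (n * n * l) theta n 0 g finset.set0 - \sum_X gibbs e lambda X * g X <= delta.
Proof.
move=> g01; have [d0 d1] := andP delta01; have [e0 e1] := andP eps01.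
have n0' : (0 < n)%N by rewrite -(ltr0n R).
have nk : (n < 2 ^ kappa)%N by rewrite ltnNge kappaP ltnn.
have k2 : (2 ^ kappa <= 2 * n)%N.
  have k0 : (0 < kappa)%N by rewrite -kappaP.
  by rewrite -(prednK k0) expnS leq_pmul2l // kappaP ltn_predL.
have eps2 : 0 < eps ^+ 2 <= 1 by rewrite exprn_gt0 // expr_le1 // ltW.
have rho01 : 0 < eps ^+ 2 / 32 <= 1 by move: eps2; set x := eps ^+ 2; lra.
have rho01' : 0 <= eps ^+ 2 / 32 <= 1 by case/andP: rho01 => /ltW -> ->.
have := anneal_error (n * n * l) e_simple nk rho01' lam_ge0 lam_prob (expR_ge0 8) lam_step bad_le
  (add0n n) g01.
(* At fugacity 0 the Gibbs distribution is the point mass at the empty set, where the program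
   starts. *)
rewrite lam0; have -> : \sum_X gibbs e (0 : R) X * anneal e l kappa (n * n * l) theta n 0 g X =
    anneal e l kappa (n * n * l) theta n 0 g finset.set0.
  rewrite (bigD1 finset.set0) //= gibbs0 eqxx mul1r big1 ?addr0 // => X /negbTE X0.
  by rewrite gibbs0 X0 mul0r.
set A := anneal _ _ _ _ _ _ _ _ _; set t := expR (- _) => H.
(* Error budget: delta / 4 for mixing, delta / 4 for bad sets, delta / 2 for the last fugacity. *)
have T1 : n%:R * ((1 - eps ^+ 2 / 32 / (2 ^ kappa)%:R) ^+ (n * n * l) * n%:R) <= delta / 4.
  have Hm : (1 - eps ^+ 2 / 32 / (2 ^ kappa)%:R) ^+ (n * n * l) <= q ^+ 2.
    apply: mixing_term_le => //; first by rewrite (ltnW nk) k2.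
    have : 128 <= eps ^+ 2 * n%:R.
      have : 1024 <= n%:R * eps ^+ 2.
        rewrite -ler_pdivrMr; last by case/andP: eps2.
        by apply: le_trans n_ge; rewrite lerDl mulr_ge0 ?ler0n // addr_ge0 // expR_ge0.
      by set x := _ * eps ^+ 2; rewrite mulrC -/x; lra.
    by move: (eps ^+ 2) => y; lra.
  apply: (@le_trans _ _ (n%:R * (q ^+ 2 * n%:R))).
    by rewrite ler_wpM2l // ler_wpM2r.
  rewrite (_ : n%:R * (q ^+ 2 * n%:R) = delta * (delta / (n%:R * n%:R))); last first.
    by rewrite /q; field; rewrite gt_eqF.
  rewrite ler_wpM2l ?(ltW d0) // -/q; apply: le_trans q_small _.
  by rewrite lef_pV2 ?posrE //; apply: le_trans n16; lra.
have T2 : n%:R * ((n * n * l)%:R * ((expR 8 + 1) * (n%:R * (2 * t)))) <= delta / 4.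
  apply: stage_error_le => //.
    apply: le_trans n_ge; rewrite lerDr divr_ge0 ?ler0n //.
    by case/andP: eps2 => /ltW.
  by rewrite expR_ge0.
have := final_gibbs g01; rewrite mulrDr in H; lra.
Qed.

End Main.

(** * Polynomial running time *)

Section TimeBound.
Variable R : realType.

Let var (i : 'I_3) : mpoly.mpoly 3 R := mpoly.mpolyX R (mpoly.mnm1 i).

(** A bound on [l]; [ord0] stands for n and [ord_max] for ln (1 / delta), squared because it may be
    negative. *)
Definition length_poly : mpoly.mpoly 3 R :=
  4%:R * var ord0 + var ord_max * var ord_max + 2%:R.

Definition time_poly : mpoly.mpoly 3 R :=
  var ord0 * (var ord0 * var ord0 * length_poly *
    (24%:R * var ord0 + 8%:R * length_poly + 35%:R) + 11%:R) + 6%:R * length_poly + 50%:R.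

Let eval_nat (v : 'I_3 -> R) k : mpoly.meval v k%:R = k%:R.
Proof. by rewrite mpoly.mevalMn mpoly.meval1. Qed.

Lemma eval_time_poly x y z : let b := 4 * x + z * z + 2 in
  eval3 time_poly x y z = x * (x * x * b * (24 * x + 8 * b + 35) + 11) + 6 * b + 50.
Proof.
rewrite /eval3; set v : 'I_3 -> R := fun i => _; rewrite /time_poly /=.
have vx : mpoly.meval v (var ord0) = x by exact: mpoly.mevalXU.
have vz : mpoly.meval v (var ord_max) = z by exact: mpoly.mevalXU.
have vb : mpoly.meval v length_poly = 4 * x + z * z + 2.
  by rewrite /length_poly 2!mpoly.mevalD 2!mpoly.mevalM !eval_nat vx vz.
have -> (a b k1 k2 k3 k4 k5 k6 : mpoly.mpoly 3 R) : mpoly.meval v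
    (a * (a * a * b * (k1 * a + k2 * b + k3) + k4) + k5 * b + k6) =
    let a := mpoly.meval v a in let b := mpoly.meval v b in
    a * (a * a * b * (mpoly.meval v k1 * a + mpoly.meval v k2 * b + mpoly.meval v k3) +
    mpoly.meval v k4) + mpoly.meval v k5 * b + mpoly.meval v k6.
  by rewrite !(mpoly.mevalD, mpoly.mevalM).
by rewrite /= vb vx !eval_nat.
Qed.

Let log_bound (a x y z c : R) : y * z <= a + (a + c) -> a < x -> 2^-1 <= z -> 0 <= y ->
  y + 1 <= 4 * x + c * c + 2.
Proof. by have := sqr_ge0 (c - 1); rewrite expr2; nra. Qed.

(** Take logarithms in 2 ^ (l - 1) <= n ^ 2 / delta, then use ln 2 >= 1 / 2, ln n < n and 2 c <= c ^
    2 + 1 for c = ln (1 / delta). *)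
Lemma binary_length_le (n l : nat) (delta : R) : 0 < delta ->
  (forall s, (2 ^+ s <= n%:R * n%:R / delta) = (s < l)%N) ->
  l%:R <= 4 * n%:R + ln (1 / delta) * ln (1 / delta) + 2.
Proof.
move=> d0 lP; have [->|] := posnP l; first by rewrite addr_ge0 // addr_ge0 // -expr2 sqr_ge0.
move=> l0; have := lP l.-1; rewrite ltn_predL l0; set k := l.-1 => Hk.
have -> : l%:R = k%:R + 1 :> R by rewrite /k -(prednK l0) mulrSr.
have n0 : (0 < n)%N.
  by rewrite lt0n; apply/negP => /eqP n0; move: Hk; rewrite n0 !mul0r leNgt exprn_gt0.
have n0R : 0 < n%:R :> R by rewrite ltr0n.
have : ln (2 ^+ k) <= ln (n%:R * n%:R / delta).
  by rewrite ler_ln ?posrE ?exprn_gt0 ?divr_gt0 ?mulr_gt0.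
rewrite lnXn // -mulrA lnM ?posrE ?divr_gt0 // lnM ?posrE ?invr_gt0 // div1r.
rewrite -[ln 2 *+ k]mulr_natl => H; exact: log_bound H (ln_sublinear n0R) (half_ln2 R) (ler0n R k).
Qed.

Lemma program_time_le (n l kappa : nat) (b : R) : (kappa <= n)%N -> l%:R <= b ->
  (program_time n l kappa)%:R <=
    n%:R * (n%:R * n%:R * b * (24 * n%:R + 8 * b + 35) + 11) + 6 * b + 50 :> R.
Proof.
move=> kn lb; have l0 : 0 <= l%:R :> R by [].
have n0 : 0 <= n%:R :> R by [].
apply: (@le_trans _ _ (n%:R * (n%:R * n%:R * l%:R * (24 * n%:R + 8 * l%:R + 35) + 11) +
    6 * l%:R + 50)).
  rewrite -!(natrM, natrD) ler_nat /program_time /stage_time /step_time.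
  rewrite !leq_add2r leq_mul2l -addnA leq_add2r leq_mul2l; apply/orP; right.
  by apply/orP; right; lia.
rewrite lerD2r lerD //; last by rewrite ler_wpM2l.
rewrite ler_wpM2l // lerD2r ler_pM ?mulr_ge0 ?addr_ge0 ?mulr_ge0 //.
  by rewrite ler_wpM2l // mulr_ge0.
by rewrite lerD2r lerD2l ler_wpM2l.
Qed.

End TimeBound.

(** * From expectations to the law and the support of the output *)

Section OutputDistribution.
Variables (R : realType) (n : nat) (e : rel 'I_n) (c : config R) (T : nat).

Lemma sum_output_dist (h : {set 'I_n} -> R) :
  \sum_X output_dist e c T X * h X = expect e T (fun c => h (output n c)) c.
Proof.
rewrite expectE mulr_suml (eq_bigr (fun X => \sum_(bits : T.-tuple bool)
    (output n (run e c bits) == X)%:R * h X / 2 ^+ T)); last first.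
  move=> X _; rewrite /output_dist -sum1_card natr_sum -mulr_suml -mulr_suml mulrAC.
  congr (_ * _ / _); rewrite big_mkcond; apply: eq_bigr => bits _.
  by rewrite inE; case: ifP.
rewrite exchange_big; apply: eq_bigr => bits _ /=.
rewrite (bigD1 (output n (run e c bits))) //= eqxx mul1r big1 ?addr0 // => X.
by rewrite eq_sym => /negbTE ->; rewrite !mul0r.
Qed.

(** Applied to the indicator of failure, this turns a statement on expectations into one on every
    run. *)
Lemma expect_eq0 (F : config R -> R) : (forall c, 0 <= F c) -> expect e T F c = 0 ->
  forall bits : T.-tuple bool, F (run e c bits) = 0.
Proof.
move=> F0; rewrite expectE => /eqP; rewrite mulf_eq0 invr_eq0 expf_eq0 pnatr_eq0 andbF orbF.
by move=> /eqP H bits; apply: (psumr_eq0P _ H).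
Qed.

End OutputDistribution.

(** * Choice of constants and degenerate cases *)

Theorem theorem1p5 (R : realType) :
  exists (A : program) (p : mpoly.mpoly 3 R),
  forall eps : R, 0 < eps ->
  exists C : R, 0 < C /\
  forall delta : R, 0 < delta ->
  forall (n D : nat) (e : rel 'I_n) (lambda : R),
    simple_graph e ->
    regular e D ->
    (6%:E <= girth R e)%E ->
    C * ln (n%:R / delta) <= D%:R ->
    0 < lambda ->
    lambda <= (1 - eps) * expR 1 / D%:R ->
  exists T : nat,
    [/\ T%:R <= eval3 p n%:R (1 / eps) (ln (1 / delta)),
        forall bits : T.-tuple bool,
          let c := run e (init n lambda eps delta A) bits in
          halted c /\ independent e (output n c)
      & tv_dist (output_dist e (init n lambda eps delta A) T)
                (gibbs e lambda) <= delta].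
Proof.
exists annealed_glauber, (time_poly R) => eps eps0.
pose gamma := (eps ^+ 2 / 128) ^+ 2 / 8.
pose N1 := 1024 / eps ^+ 2 + 16 * (expR 8 + 1).
have gamma0 : 0 < gamma by rewrite !(divr_gt0, exprn_gt0).
have ln2 : 0 < ln 2 :> R by rewrite (lt_le_trans _ (half_ln2 R)) // invr_gt0.
have Na : 0 <= 1024 / eps ^+ 2 by rewrite divr_ge0 ?ler0n // exprn_ge0 // ltW.
have Nb : 0 <= 16 * (expR 8 + 1) :> R by rewrite mulr_ge0 ?ler0n // addr_ge0 ?expR_ge0.
have N10 : 0 <= N1 by rewrite addr_ge0.
have C1 : 0 < 9 / gamma by rewrite divr_gt0.
have C2 : 0 <= N1 / ln 2 by rewrite divr_ge0 // ltW.
(* The first summand makes the tail at most (delta / n) ^ 9. The second makes D, and with it n, at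
   least [N1], once ln (n / delta) >= ln 2. *)
exists (9 / gamma + N1 / ln 2); split; first by rewrite ltr_wpDr.
move=> delta delta0 n D e lambda e_simple reg girth6 D_ge lambda0 lambda_le.
have [kappa kappaR] := binary_length_exists (n%:R : R).
have kappaP s : (2 ^ s <= n)%N = (s < kappa)%N by rewrite -kappaR -natrX ler_nat.
have [l lP] := binary_length_exists (n%:R * n%:R / delta).
have kn : (kappa <= n)%N by rewrite leqNgt -kappaP -ltnNge ltn_expl.
have nk : (n < 2 ^ kappa)%N by rewrite ltnNge kappaP ltnn.
set c := init n lambda eps delta annealed_glauber.
have run_value F g : (forall m, F ([::], m) = g (output n ([::], m))) ->
    expect e (program_time n l kappa) F c =
    anneal e l kappa (n * n * l) (threshold_step n lambda l) n 0 g finset.set0.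
  by move=> HF; exact: (value_annealed_glauber e lambda eps kappaP lP HF (leqnn _)).
have l0 := ltW lambda0.
exists (program_time n l kappa); split.
- rewrite eval_time_poly; apply: program_time_le kn _.
  exact: binary_length_le delta0 lP.
(* Failure has expectation 0: the program has halted, and updates preserve independence. *)
- pose F (c : config R) : R := (~~ (halted c && independent e (output n c)))%:R.
  move=> bits; have : F (run e c bits) = 0.
    apply: expect_eq0 => //.
    rewrite (run_value F (fun X => (~~ independent e X)%:R)) //.
    by apply: anneal_independent => // [X ->|] //; exact: independent0.
  by rewrite /F; case: (halted _) => //=; case: independent => //= /eqP; rewrite oner_eq0.
- have sum_value g : \sum_X output_dist e c (program_time n l kappa) X * g X =
      anneal e l kappa (n * n * l) (threshold_step n lambda l) n 0 g finset.set0.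
    by rewrite sum_output_dist; exact: run_value.
  apply: tv_dist_le; last (move=> g g01; rewrite sum_value).
  + rewrite (eq_bigr (fun X => output_dist e c (program_time n l kappa) X * 1)) => [|X _].
      by rewrite sum_output_dist expectE; under eq_bigr do rewrite /=; rewrite
        sumr_const card_tuple card_bool -natrX divff // pnatr_eq0 -lt0n expn_gt0.
    by rewrite mulr1.
  + exact: sum_gibbs.
  have H1 := anneal01 l (n * n * l) e (threshold_step n lambda l) nk n 0 g01 finset.set0.
  (* Means of [g] differ by at most 1, which settles delta >= 1. *)
  have [d1|d1] := leP 1 delta.
    have : 0 <= \sum_X gibbs e lambda X * g X.
      by apply: sumr_ge0 => X _; rewrite mulr_ge0 ?gibbs_ge0 //; case/andP: (g01 X).
    by case/andP: H1 => _; lra.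
  have [n0|n0] := posnP n.
    subst n; rewrite /= (eq_bigr (fun X => gibbs e lambda X * g finset.set0)) => [|X _].
      by rewrite -mulr_suml sum_gibbs // mul1r subrr ltW.
    by congr (_ * g _); apply/setP => -[].
  have n0R : 0 < n%:R :> R by rewrite ltr0n.
  (* Otherwise the upper bound on lambda would be nonpositive. *)
  have eps1 : eps <= 1.
    rewrite leNgt; apply/negP => e1; move: lambda_le; rewrite leNgt => /negP; apply.
    apply: le_lt_trans lambda0; rewrite mulr_le0_ge0 ?invr_ge0 //.
    by rewrite mulr_le0_ge0 ?expR_ge0 // subr_le0 ltW.
  (* Division by 0 gives 0, so D = 0 would force lambda <= 0. *)
  have D0 : (0 < D)%N.
    rewrite lt0n; apply/negP => /eqP D0; move: lambda_le.
    by rewrite D0 invr0 mulr0 leNgt lambda0.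
  (* No vertex is its own neighbour. With D > 0 this yields n >= 2, hence n / delta >= 2 as delta <
     1. *)
  have Dn : (D < n)%N.
    have [_ e_irr] := e_simple; pose v := Ordinal n0.
    rewrite -(reg v) -[ltnRHS]card_ord (cardD1 v 'I_n) /= ltnS.
    by apply/subset_leq_card/fintype.subsetP => w vw; rewrite !inE andbT; apply: contraTneq vw => ->;
      rewrite unfold_in e_irr.
  have n2 : 2 <= n%:R :> R by rewrite (ler_nat _ 2); exact: leq_ltn_trans D0 Dn.
  set L := ln (n%:R / delta) in D_ge.
  have L2 : ln 2 <= L.
    rewrite ler_ln ?posrE ?divr_gt0 // ler_pdivlMr //; apply: le_trans n2.
    by rewrite ler_piMr // ltW.
  have L0 : 0 < L := lt_le_trans ln2 L2.
  have DN : N1 <= D%:R.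
    apply: le_trans D_ge; rewrite mulrDl -[leLHS]add0r; apply: lerD.
      by rewrite mulr_ge0 // ltW.
    by rewrite mulrAC ler_pdivlMr // ler_wpM2l.
  have tail : expR (- (gamma * D%:R)) <= (delta / n%:R) ^+ 9.
    have -> : delta / n%:R = expR (- L) by rewrite expRN lnK ?posrE ?divr_gt0 // invf_div.
    rewrite -expRM_natr ler_expR mulNr lerN2 mulrC -ler_pdivrMl // mulrA [_ * 9]mulrC.
    by apply: le_trans D_ge; rewrite [leRHS]mulrDl lerDl mulr_ge0 // ltW.
  apply: (anneal_close e_simple reg girth6 lambda0 _ _ lambda_le _ _ tail kappaP lP g01).
  - by rewrite eps0.
  - by rewrite delta0 ltW.
  - by apply: le_trans DN; rewrite /N1 lerDl.
  - by apply: le_trans DN _; rewrite ler_nat ltnW.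
Qed.
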